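(* Let $k$ be algebraically closed of characteristic $p>0$, $G=\mathrm{GL}_n(k)$, $\nu$ a composition of $n$, $P=P_\nu$, and $\lambda$ the associated partition. Let $\varphi:G\times^P\mathfrak u_P\to\overline{\mathcal O_\lambda}$, $[g,X]\mapsto gXg^{-1}$. Let $F\in k[\mathfrak g]$ be $F(X)=\prod_{i=1}^{n-1}\det\big((I_n+X)_{\le i,\le i}\big)$ and let $f_\lambda\in k[\overline{\mathcal O_\lambda}]$ be $f_\lambda(X)=\prod_{i=1}^{n-1}s_{d_{\lambda,i}}(X_{\le i,\le i})$. Consider the function $\sigma=(\varphi^*F)^{p-1}$ on $G\times^P\mathfrak u_P$ (the KLT splitting). Then the top-degree nonzero homogeneous component of $\sigma$ has degree $(p-1)\dim(G/P)$, and this component equals $(\varphi^*f_\lambda)^{p-1}$. Moreover $\varphi^*f_\lambda$ vanishes on the exceptional locus $\varphi^{-1}(\overline{\mathcal O_\lambda}\setminus\mathcal O_\lambda)$ of $\varphi$.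
   Context: $T$ is the diagonal torus, $B$ the upper triangular Borel subgroup. For a composition $\nu=(\nu_1,\dots,\nu_s)$ of $n$, $P_\nu\supseteq B$ is the standard parabolic with diagonal block sizes $\nu_1,\dots,\nu_s$ in order, and $\mathfrak u_P$ is the Lie algebra of its unipotent radical. $\lambda$ is the partition transposed to the weakly decreasing rearrangement of $\nu$ ($\lambda_j=0$ beyond its length); $\mathcal O_\lambda$ is the nilpotent orbit with Jordan type $\lambda$, which is the Richardson orbit of $P$, and $\varphi$ is a resolution (proper birational) of the normal variety $\overline{\mathcal O_\lambda}$. $d_{\lambda,i}:=i-\sum_{j>n-i}\lambda_j$. $X_{\le i,\le i}$ is the submatrix of the first $i$ rows and columns; $s_j(Y)$ is the sum of principal $j\times j$ minors of $Y$. The grading on $k[G\times^P\mathfrak u_P]$ is induced by the standard grading of $k[\mathfrak u_P]=S(\mathfrak u_P^* )$ (equivalently by scalar multiplication on the fibres). The canonical bundle of $G\times^P\mathfrak u_P$ is trivial; with a suitable choice of volume form, $\sigma$ defines a Frobenius splitting of $G\times^P\mathfrak u_P$ (the Kumar–Lauritzen–Thomsen splitting), and its homogeneous component of degree $(p-1)\dim(G/P)$ is again a splitting. *)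

(* Defs.v *)
From HB Require Import structures.
From mathcomp Require Import all_boot all_order all_algebra all_field.
From mathcomp Require Import mpoly.
Set Implicit Arguments. Unset Strict Implicit. Unset Printing Implicit Defensive.
Import GRing.Theory.
Local Open Scope ring_scope.

Definition is_composition (n : nat) (nu : seq nat) : bool :=
  all (fun r => 0 < r)%N nu && (sumn nu == n).

(* Block index (0-based) of a 0-based row/column index i for the block
   decomposition given by nu: the number of partial sums nu_1+..+nu_r
   (r >= 1) that are <= i. *)
Definition blk (nu : seq nat) (i : nat) : nat :=
  count (fun s => s <= i)%N [seq sumn (take r.+1 nu) | r <- iota 0 (size nu)].

Definition in_uP (K : ringType) (n : nat) (nu : seq nat) (X : 'M[K]_n) : Prop :=
  forall i j : 'I_n, ~~ (blk nu i < blk nu j)%N -> X i j = 0.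

(* dim P_nu = number of entries (i,j) with blk i <= blk j (P_nu is open in
   this linear space); dim (G/P) = n^2 - dim P. *)
Definition dimP (n : nat) (nu : seq nat) : nat :=
  #|[set ij : 'I_n * 'I_n | (blk nu ij.1 <= blk nu ij.2)%N]|.
Definition dimGP (n : nat) (nu : seq nat) : nat := (n * n - dimP n nu)%N.

(* lambda = transpose of (the sorted) nu; lambda_j (1-based j) = #{r : nu_r >= j} *)
Definition lam (nu : seq nat) (j : nat) : nat := count (fun r => j <= r)%N nu.
Definition lamseq (n : nat) (nu : seq nat) : seq nat :=
  [seq lam nu j | j <- iota 1 n & (0 < lam nu j)%N].

(* d_{lambda,i} = i - sum_{j > n-i} lambda_j  (lambda_j = 0 for j > n) *)
Definition dli (n : nat) (nu : seq nat) (i : nat) : nat :=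
  (i - \sum_((n - i).+1 <= j < n.+1) lam nu j)%N.

Definition jordan_nil (K : ringType) (n : nat) (s : seq nat) : 'M[K]_n :=
  \matrix_(i, j) (if ((j : nat) == i.+1) && (blk s i == blk s j) then 1 else 0).

Definition in_Olam (K : fieldType) (n : nat) (nu : seq nat) (X : 'M[K]_n) : Prop :=
  exists g : 'M[K]_n, g \in unitmx /\ X = g *m jordan_nil K n (lamseq n nu) *m invmx g.

Definition mxe (R : ringType) (n : nat) (M : 'M[R]_n) (a b : nat) : R :=
  match insub a, insub b with Some i, Some j => M i j | _, _ => 0 end.

Definition lead_sub (R : ringType) (n : nat) (M : 'M[R]_n) (i : nat) : 'M[R]_i :=
  \matrix_(a < i, b < i) mxe M a b.

Definition principal_sub (R : ringType) (m : nat) (Y : 'M[R]_m) (S : {set 'I_m})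
  : 'M[R]_#|S| := \matrix_(a, b) Y (enum_val a) (enum_val b).
Definition sminors (R : comRingType) (m : nat) (j : nat) (Y : 'M[R]_m) : R :=
  \sum_(S : {set 'I_m} | #|S| == j) \det (principal_sub Y S).

Definition Xgen (K : comRingType) (n : nat) : 'M[{mpoly K[n * n]}]_n :=
  \matrix_(i, j) 'X_(mxvec_index i j).

Definition evalmx (K : comRingType) (n : nat) (q : {mpoly K[n * n]}) (Y : 'M[K]_n) : K :=
  q.@[fun k => mxvec Y 0 k].

Definition Fpoly (K : comRingType) (n : nat) : {mpoly K[n * n]} :=
  \prod_(1 <= i < n) \det (lead_sub (1%:M + Xgen K n) i).

Definition flam (K : comRingType) (n : nat) (nu : seq nat) : {mpoly K[n * n]} :=
  \prod_(1 <= i < n) sminors (dli n nu i) (lead_sub (Xgen K n) i).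

Definition hpart (K : comRingType) (N : nat) (d : nat) (q : {mpoly K[N]}) : {mpoly K[N]} :=
  \sum_(m <- msupp q | mdeg m == d) q@_m *: 'X_[m].

(* Main.v *)
Require Import Defs.
From HB Require Import structures.
From mathcomp Require Import all_boot all_order all_fingroup all_algebra all_field.
From mathcomp Require Import zify.
From mathcomp Require Import mpoly.
Import GRing.Theory.
Local Open Scope ring_scope.
Set Implicit Arguments.
Unset Strict Implicit.
Unset Printing Implicit Defensive.

(* Let Y = g X g^-1.  The degree-d part of F, evaluated at Y, is the coefficient
   of t^d in the product of the leading minors of 1 + tY.  Expand the i-th one
   multilinearly into minors of 1 + tX.  As X is strictly block upper triangular
   and only n - i rows and columns are missing, every nonzero Leibniz term takes
   at least sum_r max(nu_r - (n - i), 0) = i - d_{lambda,i} entries from the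
   diagonal, so the minor has degree at most d_{lambda,i}, with coefficient
   s_{d_{lambda,i}}(Y_{<=i,<=i}) there; and the d_{lambda,i} add up to dim(G/P).
   A matrix permuting basis vectors along chains, conjugated by a matrix whose
   top minors are all nonzero, attains all these degrees at once.  The same two
   facts for a Jordan matrix of type mu show that, if all the top coefficients of
   Y are nonzero, its Jordan type mu has the same tail sums as lambda. *)

(** * Sums of principal minors as coefficients of [det (1 + tY)] *)

(** A unitriangular factor on the right or on the left of the same block matrix clears its upper
    right corner and exposes one or the other determinant. *)
Lemma det_1addC (R : comNzRingType) (m n : nat) (A : 'M[R]_(m, n)) (B : 'M[R]_(n, m)) :
  \det (1%:M + A *m B) = \det (1%:M + B *m A).
Proof.
have E1 : block_mx 1%:M (- A) B 1%:M *m block_mx 1%:M A 0 1%:M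
          = block_mx 1%:M 0 B (1%:M + B *m A).
  by rewrite mulmx_block !mulmx1 !mul1mx !mulmx0 !addr0 subrr addrC.
have E2 : block_mx 1%:M A 0 1%:M *m block_mx 1%:M (- A) B 1%:M
          = block_mx (1%:M + A *m B) 0 B 1%:M.
  by rewrite mulmx_block !mulmx1 !mul1mx !mul0mx !add0r addrC addNr addrC.
have := congr1 determinant E1; have := congr1 determinant E2.
rewrite !det_mulmx !det_lblock !det1 mulr1 mul1r => <- <-.
by rewrite mulrC.
Qed.

(** Replaces a minor of size [#|S|] by a determinant of fixed size. With [E] selecting the rows in
    [S], the submatrix is [1 + E (Y - 1) E^T]; moving [E^T] to the front leaves [E^T E], the
    diagonal projector onto [S]. *)
Lemma det_principal_sub (R : comNzRingType) (m : nat) (Y : 'M[R]_m) (S : {set 'I_m}) :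
  \det (principal_sub Y S) = \det (\matrix_(a, b) if a \in S then Y a b else (a == b)%:R).
Proof.
pose E : 'M[R]_(#|S|, m) := \matrix_(a, b) (enum_val a == b)%:R.
have EE : E *m E^T = 1%:M.
  apply/matrixP=> a b; rewrite !mxE (bigD1 (enum_val a)) //= !mxE eqxx mul1r.
  rewrite big1 ?addr0 => [|k /negPf nk]; last by rewrite !mxE eq_sym nk mul0r.
  by rewrite (inj_eq enum_val_inj) eq_sym.
have -> : principal_sub Y S = 1%:M + (E *m (Y - 1%:M)) *m E^T.
  rewrite mulmxBr mulmxBl mulmx1 EE addrC subrK; apply/matrixP=> a b; rewrite !mxE.
  rewrite (bigD1 (enum_val b)) //= big1 ?addr0 => [|k /negPf nk]; last first.
    by rewrite !mxE eq_sym nk mulr0.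
  rewrite !mxE eqxx mulr1 (bigD1 (enum_val a)) //= big1 ?addr0 => [|k /negPf nk].
    by rewrite !mxE eqxx mul1r.
  by rewrite !mxE eq_sym nk mul0r.
rewrite det_1addC mulmxA; congr (\det _); apply/matrixP=> a b; rewrite 2!mxE.
have [aS|aS] := boolP (a \in S).
  rewrite !mxE aS (bigD1 a) //= big1 ?addr0 => [|k nk].
    rewrite !mxE (bigD1 (enum_rank_in aS a)) //= !mxE enum_rankK_in // eqxx mul1r.
    rewrite big1 ?addr0 ?mul1r; first by rewrite addrC subrK.
    move=> k nk; rewrite !mxE; case: eqP => [ek|_]; rewrite ?mul0r //.
    by case/negP: nk; rewrite -(inj_eq enum_val_inj) enum_rankK_in // ek.
  rewrite !mxE big1 ?mul0r // => l _; rewrite !mxE.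
  case: eqP => [el|_]; rewrite ?mul0r //.
  case: eqP => [ek|_]; rewrite ?mulr0 //.
  by case/negP: nk; rewrite -el -ek.
rewrite !mxE (negPf aS) big1 ?addr0 // => k _; rewrite !mxE big1 ?mul0r // => l _.
rewrite !mxE; case: eqP => [el|_]; rewrite ?mul0r //.
by case/negP: aS; rewrite -el enum_valP.
Qed.

(** In each Leibniz product, [S] collects the rows whose factor comes from the term in ['X]; the
    other rows are those of the identity matrix. *)
Lemma det_1addXE (R : comNzRingType) (m : nat) (Y : 'M[R]_m) :
  \det (1%:M + 'X *: map_mx polyC Y) = \sum_(S : {set 'I_m}) \det (principal_sub Y S) *: 'X^#|S|.
Proof.
have -> : \det (1%:M + 'X *: map_mx polyC Y) =
   \sum_(s : {perm 'I_m}) \sum_(S : {set 'I_m}) (-1) ^+ s *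
     ((\prod_(a in S) ('X * (Y a (s a))%:P)) * \prod_(a in ~: S) (a == s a)%:R).
  apply: eq_bigr => s _; rewrite -mulr_sumr; congr (_ * _).
  rewrite (eq_bigr (fun a => 'X * (Y a (s a))%:P + (a == s a)%:R)); last first.
    by move=> a _; rewrite !mxE addrC.
  rewrite bigA_distr; apply: eq_bigr => S _; rewrite (bigID (mem S)) /=; congr (_ * _).
    by apply: eq_bigr => a ->.
  by apply: eq_big => [a|a /negPf ->]; rewrite ?inE.
rewrite exchange_big; apply: eq_bigr => S _.
rewrite det_principal_sub -mul_polyC /determinant rmorph_sum mulr_suml.
apply: eq_bigr => s _; rewrite rmorphM rmorphXn rmorphN1 -mulrA; congr (_ * _).
rewrite big_split /= prodr_const rmorph_prod -mulrA mulrC; congr (_ * _).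
rewrite [RHS](bigID (mem S)) /=; congr (_ * _).
  by apply: eq_bigr => a aS; rewrite mxE aS.
apply: eq_big => [a|a]; first by rewrite inE.
by rewrite inE => aS; rewrite mxE (negPf aS) rmorph_nat.
Qed.

Lemma coef_det_1addX (R : comNzRingType) (m : nat) (Y : 'M[R]_m) (j : nat) :
  (\det (1%:M + 'X *: map_mx polyC Y))`_j = sminors j Y.
Proof.
rewrite det_1addXE coef_sum /sminors [RHS]big_mkcond; apply: eq_bigr => S _.
by rewrite coefZ coefXn eq_sym; case: eqP; rewrite ?mulr1 ?mulr0.
Qed.

(** * Evaluation of [Fpoly] and [flam] along the line [tY] *)

Lemma map_lead_sub (R S : nzRingType) (f : {rmorphism R -> S}) (n i : nat) (M : 'M[R]_n) :
  map_mx f (lead_sub M i) = lead_sub (map_mx f M) i.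
Proof.
apply/matrixP=> a b; rewrite !mxE /mxe.
case: insubP => [u _ _|_]; last by rewrite rmorph0.
by case: insubP => [v _ _|_]; rewrite ?rmorph0 // !mxE.
Qed.

Lemma lead_subE (R : nzRingType) (n i : nat) (le_in : (i <= n)%N) (M : 'M[R]_n) (a b : 'I_i) :
  lead_sub M i a b = M (widen_ord le_in a) (widen_ord le_in b).
Proof.
rewrite mxE /mxe.
have E (c : 'I_i) : insub (c : nat) = Some (widen_ord le_in c).
  have lt : (c < n)%N by apply: leq_trans le_in.
  by rewrite insubT; congr Some; apply: val_inj.
by rewrite !E.
Qed.

(** A polynomial in the scaling parameter, so that homogeneous components of [Fpoly] become
    coefficients. *)
Definition ldet (R : comNzRingType) (n : nat) (Y : 'M[R]_n) (i : nat) : {poly R} :=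
  \det (lead_sub (1%:M + 'X *: map_mx polyC Y) i).

Lemma coef_ldet (R : comNzRingType) (n i : nat) (Y : 'M[R]_n) (j : nat) :
  (i <= n)%N -> (ldet Y i)`_j = sminors j (lead_sub Y i).
Proof.
move=> le_in; rewrite -coef_det_1addX /ldet.
suff -> : lead_sub (1%:M + 'X *: map_mx polyC Y) i = 1%:M + 'X *: map_mx polyC (lead_sub Y i) by [].
apply/matrixP=> a b; rewrite (lead_subE le_in) !mxE.
by have := lead_subE le_in Y a b; rewrite mxE => ->.
Qed.

Lemma map_sminors (R S : comNzRingType) (f : {rmorphism R -> S}) (m j : nat) (Y : 'M[R]_m) :
  f (sminors j Y) = sminors j (map_mx f Y).
Proof.
rewrite rmorph_sum; apply: eq_bigr => A _; rewrite -det_map_mx; congr (\det _).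
by apply/matrixP=> a b; rewrite !mxE.
Qed.

Lemma map_Xgen (K : comNzRingType) (S : comNzRingType) (f : {rmorphism K -> S}) (n : nat)
   (v : 'I_(n * n) -> S) :
  map_mx (mmap f v) (Xgen K n) = \matrix_(i, j) v (mxvec_index i j).
Proof. by apply/matrixP=> i j; rewrite !mxE mmapX mmap1U. Qed.

Lemma evalmx_flam (K : comNzRingType) (n : nat) (nu : seq nat) (Y : 'M[K]_n) :
  evalmx (flam K n nu) Y = \prod_(1 <= i < n) sminors (dli n nu i) (lead_sub Y i).
Proof.
rewrite /evalmx /flam /meval rmorph_prod; apply: eq_bigr => i _.
rewrite map_sminors map_lead_sub map_Xgen; congr (sminors _ (lead_sub _ _)).
by apply/matrixP=> a b; rewrite mxE mxvecE.
Qed.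

(** Scaling every variable by ['X] multiplies a monomial of degree [e] by ['X^e]. *)
Lemma meval_hpart (K : comNzRingType) (N d : nat) (q : {mpoly K[N]}) (v : 'I_N -> K) :
  (hpart d q).@[v] = (mmap polyC (fun i => 'X * (v i)%:P) q)`_d.
Proof.
rewrite /hpart /mmap coef_sum rmorph_sum big_mkcond; apply: eq_bigr => m _ /=.
have -> : mmap1 (fun i => 'X * (v i)%:P) m = 'X^(mdeg m) * (mmap1 v m)%:P.
  rewrite /mmap1 rmorph_prod mdegE.
  rewrite (eq_bigr (fun i => 'X^(m i) * (v i)%:P ^+ m i)) => [|i _]; last exact: exprMn.
  rewrite big_split /= prodrXr; congr (_ * _).
  by apply: eq_bigr => i _; rewrite rmorphXn.
rewrite coefCM coefMC coefXn eq_sym; case: eqP => _; rewrite ?mul0r ?mulr0 //.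
by rewrite mevalZ mevalX mul1r.
Qed.

Lemma evalmx_hpart_Fpoly (K : comNzRingType) (n d e : nat) (Y : 'M[K]_n) :
  evalmx (hpart d (Fpoly K n ^+ e)) Y = ((\prod_(1 <= i < n) ldet Y i) ^+ e)`_d.
Proof.
rewrite /evalmx meval_hpart rmorphXn rmorph_prod.
suff E i : mmap polyC (fun k => 'X * (mxvec Y 0 k)%:P)
             (\det (lead_sub (1%:M + Xgen K n) i)) = ldet Y i.
  by rewrite (eq_bigr _ (fun i _ => E i)).
rewrite -det_map_mx map_lead_sub map_mxD map_mx1 map_Xgen.
congr (\det (lead_sub (_ + _) _)).
by apply/matrixP=> a b; rewrite !mxE mxvecE.
Qed.

(** * Degree bound for the leading minors of a conjugate *)

Lemma coefM_top (R : nzRingType) (p q : {poly R}) (a b : nat) :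
  (size p <= a.+1)%N -> (size q <= b.+1)%N -> (p * q)`_(a + b) = p`_a * q`_b.
Proof.
move=> sp sq; rewrite coefM.
have lt_a : (a < (a + b).+1)%N by rewrite ltnS leq_addr.
rewrite (bigD1 (Ordinal lt_a)) //= addKn big1 ?addr0 // => j /eqP nj.
have [lt|lt|ej] := ltngtP j a; last by case: nj; apply: val_inj.
  by rewrite [q`__]nth_default ?mulr0 //; apply: leq_trans sq _; lia.
by rewrite nth_default ?mul0r //; apply: leq_trans sp _.
Qed.

Lemma prod_poly_top (R : comNzRingType) (I : Type) (r : seq I) (P : pred I)
    (p : I -> {poly R}) (d : I -> nat) :
  (forall i, P i -> (size (p i) <= (d i).+1)%N) ->
  (size (\prod_(i <- r | P i) p i)%R <= (\sum_(i <- r | P i) d i).+1)%N /\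
  (\prod_(i <- r | P i) p i)`_(\sum_(i <- r | P i) d i) = \prod_(i <- r | P i) (p i)`_(d i).
Proof.
move=> sz; elim: r => [|i r [IHs IHc]]; first by rewrite !big_nil size_poly1 coef1.
rewrite !big_cons; case: ifP => [Pi|_] //; split; last by rewrite coefM_top ?IHc ?sz.
apply: leq_trans (size_polyMleq _ _) _.
apply: (@leq_trans ((d i).+1 + (\sum_(j <- r | P j) d j).+1).-1); last by lia.
by rewrite -!subn1 leq_sub2r // leq_add // sz.
Qed.

(** Cauchy-Binet over all maps [f] instead of subsets, which avoids ordering the chosen rows. *)
Lemma det_mulmx_expand (R : comNzRingType) (m n : nat) (P : 'M[R]_(m, n)) (N : 'M[R]_(n, m)) :
  \det (P *m N) = \sum_(f : {ffun 'I_m -> 'I_n})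
     (\prod_a P a (f a)) * \det (\matrix_(a, b) N (f a) b).
Proof.
transitivity (\sum_(s : {perm 'I_m}) \sum_(f : {ffun 'I_m -> 'I_n})
   (-1) ^+ s * \prod_a (P a (f a) * N (f a) (s a))).
  apply: eq_bigr => s _; rewrite -mulr_sumr -(bigA_distr_bigA (fun a b => P a b * N b (s a))).
  congr (_ * _).
  by apply: eq_bigr => a _; rewrite mxE.
rewrite exchange_big; apply: eq_bigr => f _ /=; rewrite mulr_sumr.
apply: eq_bigr => s _; rewrite big_split /= mulrCA; congr (_ * (_ * _)).
by apply: eq_bigr => a _; rewrite mxE.
Qed.

(** The outer factors are constant, so expanding along rows and then, after transposing, along
    columns leaves only minors of [M]. Repeated rows or columns give zero. *)
Lemma size_det_mulmx3 (R : comNzRingType) (m n B : nat) (P : 'M[R]_(m, n)) (M : 'M[{poly R}]_n)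
    (Q : 'M[R]_(n, m)) :
  (forall f h : 'I_m -> 'I_n, injective f -> injective h ->
     (size (\det (\matrix_(a, b) M (f a) (h b))) <= B)%N) ->
  (size (\det (map_mx polyC P *m M *m map_mx polyC Q)) <= B)%N.
Proof.
move=> szM.
have {}szM (f h : 'I_m -> 'I_n) : (size (\det (\matrix_(a, b) M (f a) (h b))) <= B)%N.
  have [/injectiveP fI|/injectivePn[a [b nab eab]]] := boolP (injectiveb f); last first.
    by rewrite (determinant_alternate nab) ?size_poly0 // => c; rewrite !mxE eab.
  have [/injectiveP hI|/injectivePn[a [b nab eab]]] := boolP (injectiveb h); last first.
    rewrite -det_tr (determinant_alternate nab) ?size_poly0 // => c; rewrite !mxE eab //.
  exact: szM.
rewrite -mulmxA det_mulmx_expand; apply: leq_trans (size_sum _ _ _) _.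
apply/bigmax_leqP => f _; under eq_bigr do rewrite mxE; rewrite -rmorph_prod /=.
rewrite mul_polyC; apply: leq_trans (size_scale_leq _ _) _.
have -> : (\matrix_(a, b) (M *m map_mx polyC Q) (f a) b)
          = (map_mx polyC Q^T *m (\matrix_(b, a) M (f a) b))^T.
  apply/matrixP=> a b; rewrite !mxE; apply: eq_bigr => c _.
  by rewrite !mxE mulrC.
rewrite det_tr det_mulmx_expand; apply: leq_trans (size_sum _ _ _) _.
apply/bigmax_leqP => h _; under eq_bigr do rewrite mxE; rewrite -rmorph_prod /=.
rewrite mul_polyC; apply: leq_trans (size_scale_leq _ _) _.
rewrite -det_tr; apply: leq_trans (szM f h).
suff -> : (\matrix_(a, b) (\matrix_(b0, a0) M (f a0) b0) (h a) b)^T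
  = \matrix_(a, b) M (f a) (h b) by [].
by apply/matrixP=> a b; rewrite !mxE.
Qed.

(* If a row of level [>= r] is not matched with itself, it is matched with a
   column of level [> r]; there are too few such columns. *)
Lemma card_fixed_level (m n : nat) (lev : 'I_n -> nat) (f h : 'I_m -> 'I_n) (r : nat) :
  injective f -> injective h -> (forall a, f a = h a \/ (lev (f a) < lev (h a))%N) ->
  (#|[set b | lev b == r]| - (n - m) <= #|[set a | (f a == h a) && (lev (f a) == r)]|)%N.
Proof.
move=> fI hI fh.
have cardf : (#|[set b | r <= lev b]| <= #|[set a | r <= lev (f a)]| + (n - m))%N.
  rewrite -(card_imset [set a | (r <= lev (f a))%N] fI).
  have -> : (n - m)%N = #|~: [set f a | a in 'I_m]|.
    by rewrite cardsCs setCK card_imset // !card_ord.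
  apply: leq_trans (leq_card_setU _ _); apply: subset_leq_card.
  apply/subsetP=> b; rewrite !inE => rb.
  have [/imsetP[a _ eb]|] := boolP (b \in [set f a | a in 'I_m]); last by rewrite orbT.
  by rewrite orbF; apply/imsetP; exists a; rewrite // inE -eb.
have cardh : (#|[set a | (r < lev (h a))%N]| <= #|[set b | (r < lev b)%N]|)%N.
  rewrite -(card_imset [set a | (r < lev (h a))%N] hI); apply: subset_leq_card.
  by apply/subsetP=> b /imsetP[a]; rewrite !inE => ra ->.
have split_lev : (#|[set b | (r <= lev b)%N]| =
    #|[set b | lev b == r]| + #|[set b | (r < lev b)%N]|)%N.
  rewrite -cardsUI [X in (_ + X)%N](_ : _ = 0)%N ?addn0; last first.
    by apply/eqP; rewrite cards_eq0; apply/eqP/setP=> b; rewrite !inE; lia.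
  by congr #|pred_of_set _|; apply/setP=> b; rewrite !inE; lia.
have : (#|[set a | (r <= lev (f a))%N]| <=
    #|[set a | (f a == h a) && (lev (f a) == r)]| + #|[set a | (r < lev (h a))%N]|)%N.
  apply: leq_trans (leq_card_setU _ _); apply: subset_leq_card.
  apply/subsetP=> a; rewrite !inE => ra.
  have [e|lt] := fh a; last by rewrite (leq_ltn_trans ra lt) orbT.
  by rewrite -e eqxx /=; lia.
lia.
Qed.

(** [lev] is any grading that the nonzero entries of [X] strictly raise: later the block index for
    [in_uP], and the offset in a block for a Jordan matrix. The leading block is [P (1 + tX) Q] with
    constant outer factors, so bounding minors of [1 + tX] is enough. *)
Lemma size_ldet_conj (K : comNzRingType) (n i L : nat) (lev : 'I_n -> nat) (g X h : 'M[K]_n) :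
  (i <= n)%N -> g *m h = 1%:M -> (forall a b, X a b != 0 -> (lev a < lev b)%N) ->
  (size (ldet (g *m X *m h) i) <=
     (i - \sum_(r < L) (#|[set a | lev a == r]| - (n - i))).+1)%N.
Proof.
move=> le_in gh levX.
pose w := widen_ord le_in.
pose P : 'M[K]_(i, n) := rowsub w g; pose Q : 'M[K]_(n, i) := colsub w h.
have -> : ldet (g *m X *m h) i =
    \det (map_mx polyC P *m (1%:M + 'X *: map_mx polyC X) *m map_mx polyC Q).
  have E : 1%:M + 'X *: map_mx polyC (g *m X *m h) =
     map_mx polyC g *m (1%:M + 'X *: map_mx polyC X) *m map_mx polyC h.
    by rewrite mulmxDr mulmx1 mulmxDl -scalemxAr -scalemxAl -!map_mxM gh map_mx1.
  rewrite /ldet E; congr (\det _); apply/matrixP=> a b; rewrite (lead_subE le_in) mxE [RHS]mxE.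
  apply: eq_bigr => c _; congr (_ * _); last by rewrite !mxE.
  by rewrite mxE [RHS]mxE; apply: eq_bigr => d _; rewrite !mxE.
apply: size_det_mulmx3 => f k fI kI.
apply: leq_trans (size_sum _ _ _) _; apply/bigmax_leqP => s _.
rewrite -signr_odd; apply: (@leq_trans (size (\prod_(a < i)
  (\matrix_(a, b) (1%:M + 'X *: map_mx polyC X) (f a) (k b)) a (s a))%R)).
  by case: (odd s); rewrite ?expr1 ?expr0 ?mulN1r ?mul1r ?size_opp.
have ksI : injective (fun a => k (s a)) by apply: inj_comp kI (@perm_inj _ s).
have Ea a : (\matrix_(a, b) (1%:M + 'X *: map_mx polyC X) (f a) (k b)) a (s a)
    = (f a == k (s a))%:R + 'X * (X (f a) (k (s a)))%:P by rewrite !mxE.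
(* A factor that is neither on the diagonal of [1 + tX] nor raises the level is zero, and kills the
   whole term. *)
have [/forallP fk|] := boolP [forall a, (f a == k (s a)) || (lev (f a) < lev (k (s a)))%N];
    last first.
  rewrite negb_forall => /existsP[a]; rewrite negb_or => /andP[/negPf ne nlt].
  rewrite (bigD1 a) //= Ea ne add0r; have [->|/levX] := eqVneq (X (f a) (k (s a))) 0.
    by rewrite polyC0 mulr0 mul0r size_poly0.
  by rewrite (negPf nlt).
(* A diagonal factor is the constant 1, because [levX] forces a zero diagonal in [X]. *)
have sz1 (a : 'I_i) : true ->
    (size ((\matrix_(a, b) (1%:M + 'X *: map_mx polyC X) (f a) (k b)) a (s a))%R <=
     (f a != k (s a)).+1)%N.
  rewrite Ea; case: eqP => [e|ne] _ /=.
    suff -> : X (f a) (k (s a)) = 0 by rewrite polyC0 mulr0 addr0 size_poly1.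
    by apply/eqP; apply/negP => /negP/levX; rewrite e ltnn.
  rewrite add0r mulrC; apply: leq_trans (size_polyMleq _ _) _; rewrite size_polyX.
  by have := size_polyC_leq1 (X (f a) (k (s a))); lia.
have [szp _] := prod_poly_top (index_enum 'I_i) sz1.
apply: leq_trans szp _; rewrite ltnS.
(* Sum [card_fixed_level] over the levels; a row has one level and is counted at most once. *)
have fixed_le : (\sum_(r < L) (#|[set a | lev a == r]| - (n - i)) <=
    #|[set a | f a == k (s a)]|)%N.
  apply: (@leq_trans (\sum_(r < L) #|[set a | (f a == k (s a)) && (lev (f a) == r)]|)).
    apply: leq_sum => r _; apply: card_fixed_level => // a.
    by case/orP: (fk a) => [/eqP|]; [left | right].
  rewrite -sum1_card.
  rewrite (eq_bigr (fun r : 'I_L => \sum_(a < i)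
    if a \in [set a | (f a == k (s a)) && (lev (f a) == r)] then 1 else 0)%N) => [|r _]; last first.
    by rewrite -sum1_card big_mkcond.
  rewrite exchange_big [X in (_ <= X)%N]big_mkcond; apply: leq_sum => a _ /=.
  under eq_bigr do rewrite inE.
  rewrite inE; case: eqP => [_|_] /=; last by rewrite big1.
  rewrite -big_mkcond sum1_card; apply/card_le1_eqP => r r' /eqP e /eqP e'.
  by apply: val_inj; rewrite /= -e -e'.
have := cardsC [set a | f a == k (s a)]; rewrite card_ord.
have -> : (\sum_(a < i) (f a != k (s a)))%N = #|~: [set a | f a == k (s a)]|.
  by rewrite -sum1_card [RHS]big_mkcond; apply: eq_bigr => a _; rewrite !inE; case: eqP.
lia.
Qed.

(** * Blocks, offsets and counting of indices *)

(** The 0-based offset of [i] inside its block. Together with [blk] it turns an index into a box of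
    the diagram with row lengths [s]. *)
Definition pos (s : seq nat) (i : nat) : nat := (i - sumn (take (blk s i) s))%N.

Lemma blk_cons_small (k i : nat) (s : seq nat) : (i < k)%N -> blk (k :: s) i = 0%N.
Proof.
move=> lt_ik; apply/eqP; rewrite -leqn0 leqNgt -has_count -all_predC.
by apply/allP=> _ /mapP[r _ ->] /=; lia.
Qed.

Lemma blk_cons_add (k i : nat) (s : seq nat) : blk (k :: s) (k + i) = (blk s i).+1.
Proof.
rewrite /blk /= take0 /= addn0 leq_addr add1n -[1%N]addn0 iotaDl -map_comp !count_map.
by congr _.+1; apply: eq_count => r /=; rewrite leq_add2l.
Qed.

Lemma pos_cons_small (k i : nat) (s : seq nat) : (i < k)%N -> pos (k :: s) i = i.
Proof. by move=> lt_ik; rewrite /pos blk_cons_small // take0 subn0. Qed.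

Lemma pos_cons_add (k i : nat) (s : seq nat) : pos (k :: s) (k + i) = pos s i.
Proof. by rewrite /pos blk_cons_add /= subnDl. Qed.

Lemma blk_mono (s : seq nat) (a b : nat) : (a <= b)%N -> (blk s a <= blk s b)%N.
Proof. by move=> le_ab; apply: sub_count => k /= /leq_trans; apply. Qed.

Lemma blk_start (s : seq nat) (i : nat) : (sumn (take (blk s i) s) <= i)%N.
Proof.
elim: s i => // k s IHs i; have [lt|le] := ltnP i k; first by rewrite blk_cons_small.
by rewrite -{2}(subnKC le) -{1}(subnKC le) blk_cons_add /= leq_add2l.
Qed.

Lemma blk_pos_lt (s : seq nat) (a b : nat) :
  (a < b)%N -> blk s a = blk s b -> (pos s a < pos s b)%N.
Proof.
by move=> lt_ab e; rewrite /pos -e; have := blk_start s a; lia.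
Qed.

(** The bijection between indices and boxes, by peeling off the first block; the counts below are
    read off from it. *)
Lemma sum_blk_pos (s : seq nat) (f : nat -> nat -> nat) :
  (\sum_(i < sumn s) f (blk s i) (pos s i) =
   \sum_(r < size s) \sum_(q < nth 0 s r) f r q)%N.
Proof.
elim: s f => [|k s IHs] f /=; first by rewrite !big_ord0.
rewrite big_split_ord big_ord_recl /=; congr (_ + _)%N.
  by apply: eq_bigr => i _; rewrite blk_cons_small ?pos_cons_small.
rewrite -(IHs (fun r => f r.+1)); apply: eq_bigr => i _ /=.
by rewrite blk_cons_add pos_cons_add.
Qed.

Lemma card_blk_pos (n : nat) (s : seq nat) (P : nat -> nat -> bool) : sumn s = n ->
  (#|[set b : 'I_n | P (blk s b) (pos s b)]| = \sum_(r < size s) \sum_(q < nth 0 s r) P r q)%N.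
Proof.
move=> <-; rewrite -(sum_blk_pos s (fun a b => P a b)) -sum1_card big_mkcond.
by apply: eq_bigr => i _; rewrite inE; case: (P _ _).
Qed.

Lemma sum_geq_ord (k m : nat) : (\sum_(q < k) (m <= q) = k - m)%N.
Proof. by elim: k => [|k IHk]; rewrite ?big_ord0 // big_ord_recr /= IHk; lia. Qed.

Lemma sum_ltn_ord (k m : nat) : (\sum_(q < k) (q < m) = minn k m)%N.
Proof. by elim: k => [|k IHk]; rewrite ?big_ord0 ?min0n // big_ord_recr /= IHk; lia. Qed.

Lemma sum_eq_ord (k m : nat) : (\sum_(q < k) (q == m :> nat) = (m < k))%N.
Proof. by elim: k => [|k IHk]; rewrite ?big_ord0 // big_ord_recr /= IHk; lia. Qed.

Lemma card_blk_eq (n r : nat) (s : seq nat) : sumn s = n ->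
  #|[set b : 'I_n | blk s b == r]| = nth 0%N s r.
Proof.
move=> sn; rewrite (card_blk_pos (fun a _ => a == r) sn).
have [lt|ge] := ltnP r (size s); last first.
  rewrite nth_default // big1 // => i _; rewrite big1 // => q _.
  by case: eqP => // e; have := ltn_ord i; lia.
rewrite (bigD1 (Ordinal lt)) //= [X in (_ + X)%N]big1 => [|i /eqP ni].
  under eq_bigr do rewrite eqxx.
  by rewrite sum1_card card_ord addn0.
by rewrite big1 // => q _; case: eqP => // e; case: ni; apply: val_inj.
Qed.

Lemma card_blk_geq (n m : nat) (s : seq nat) : sumn s = n ->
  #|[set b : 'I_n | (m <= blk s b)%N]| = sumn (drop m s).
Proof.
move=> sn; rewrite (card_blk_pos (fun a _ => (m <= a)%N) sn).
elim: s m {n sn} => [|k s IHs] m /=; first by rewrite big_ord0.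
rewrite big_ord_recl /=; case: m => [|m] /=.
  rewrite sum_nat_const card_ord muln1; congr (_ + _)%N.
  by rewrite -[in RHS](drop0 s) -IHs.
by rewrite big1 // -IHs.
Qed.

Lemma card_pos_geq (n m : nat) (s : seq nat) : sumn s = n ->
  #|[set b : 'I_n | (m <= pos s b)%N]| = (\sum_(k <- s) (k - m))%N.
Proof.
move=> sn; rewrite (card_blk_pos (fun _ q => (m <= q)%N) sn) (big_nth 0%N) big_mkord.
by apply: eq_bigr => r _; exact: sum_geq_ord.
Qed.

Lemma card_pos_eq (n m : nat) (s : seq nat) : sumn s = n ->
  #|[set b : 'I_n | pos s b == m]| = count (ltn m) s.
Proof.
move=> sn; rewrite (card_blk_pos (fun _ q => (q == m)%N) sn).
rewrite -sumn_count sumnE big_map (big_nth 0%N) big_mkord.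
by apply: eq_bigr => r _; exact: sum_eq_ord.
Qed.

(** * Tail sums of the transposed partition and [dim (G/P)] *)

(** At [m = n - i] this makes the truncated subtraction in [dli] exact. *)
Lemma sum_truncated_subn (m : nat) (s : seq nat) :
  (\sum_(k <- s) (k - m) <= sumn s - m)%N.
Proof. by elim: s => [|k s IHs]; rewrite ?big_nil // big_cons /=; lia. Qed.

Lemma sum_leq_nat (k m n : nat) : (\sum_(m.+1 <= j < n.+1) (j <= k) = minn n k - m)%N.
Proof.
elim: n => [|n IHn]; first by rewrite big_geq ?min0n.
have [le_nm|lt_mn] := leqP n.+1 m; first by rewrite big_geq //; lia.
by rewrite big_nat_recr //= IHn; lia.
Qed.

(** After exchanging the sums, a part [k] counts the [j] with [m < j <= k]; all of them are in range
    since [k <= n]. *)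
Lemma sum_lam (n m : nat) (s : seq nat) : sumn s = n ->
  (\sum_(m.+1 <= j < n.+1) lam s j = \sum_(k <- s) (k - m))%N.
Proof.
move=> sn; rewrite (eq_bigr (fun j => \sum_(k <- s) (j <= k)))%N => [|j _]; last first.
  by rewrite /lam -sumn_count sumnE big_map.
rewrite exchange_big [LHS]big_seq [RHS]big_seq; apply: eq_bigr => k ks /=.
have le_kn : (k <= n)%N by rewrite -sn sumnE (big_rem k ks) /= leq_addr.
by rewrite sum_leq_nat; lia.
Qed.

Lemma dliE (n i : nat) (nu : seq nat) : sumn nu = n ->
  dli n nu i = (i - \sum_(k <- nu) (k - (n - i)))%N.
Proof. by move=> nun; rewrite /dli sum_lam. Qed.

(** [count (ltn r) s] is the length of column [r] of the diagram of [s]. As the rows decrease,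
    dropping the first [m] of them shortens each column by [m], or empties it. *)
Lemma sum_sorted_subn (n m : nat) (s : seq nat) : sorted geq s -> all (leq^~ n) s ->
  (\sum_(r < n) (count (ltn r) s - m) = sumn (drop m s))%N.
Proof.
move=> ss /allP sn.
rewrite (eq_bigr (fun r : 'I_n => count (ltn r) (drop m s))) => [|r _]; last first.
  elim: s m ss {sn} => [|k s IHs] [|m] //= sks; rewrite ?subn0 //.
  have [lt|ge] := ltnP r k; first by rewrite -IHs ?(path_sorted sks) // add1n subSS.
  rewrite add0n -IHs ?(path_sorted sks) //.
  suff -> : count (ltn r) s = 0%N by [].
  apply/eqP; rewrite -leqn0 leqNgt -has_count -all_predC; apply/allP=> j js /=.
  by have /allP/(_ j js) := order_path_min (rev_trans leq_trans) sks; rewrite /=; lia.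
rewrite (eq_bigr (fun r : 'I_n => \sum_(k <- drop m s) (r < k)))%N => [|r _]; last first.
  by rewrite -sumn_count sumnE big_map.
rewrite exchange_big sumnE [LHS]big_seq [RHS]big_seq; apply: eq_bigr => k /mem_drop/sn /= le_kn.
by rewrite sum_ltn_ord; lia.
Qed.

(** Reversing the summation gives [1 + ... + (k - 1)], doubled to avoid a division. *)
Lemma sum_subn_iota (k n : nat) : (k <= n)%N ->
  (2 * \sum_(1 <= i < n) (k - (n - i)) + k = k * k)%N.
Proof.
move=> le_kn; rewrite big_nat_rev /= big_nat_cond.
rewrite (eq_bigr (fun i => (k - i)%N)) => [|i]; last by rewrite andbT; lia.
rewrite -big_nat_cond; elim: k le_kn => [|k IHk] lt_kn; first by rewrite big1.
have := IHk (ltnW lt_kn).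
rewrite [in X in _ -> X](eq_bigr (fun i => (k - i) + (i <= k)))%N => [|i _]; last by lia.
rewrite big_split /=; case: n lt_kn {IHk} => // n le_kn.
by rewrite sum_leq_nat; lia.
Qed.

Lemma sum_card_blk_eq (n : nat) (nu : seq nat) : sumn nu = n ->
  (\sum_(a < n) \sum_(b < n) (blk nu a == blk nu b) = \sum_(k <- nu) k * k)%N.
Proof.
move=> nun; rewrite (eq_bigr (fun a : 'I_n => nth 0 nu (blk nu a)))%N => [|a _]; last first.
  rewrite -(card_blk_eq (blk nu a) nun) -sum1_card [RHS]big_mkcond /=.
  by apply: eq_bigr => b _; rewrite inE eq_sym; case: eqP.
rewrite -{}nun (sum_blk_pos nu (fun r _ => nth 0 nu r)%N) (big_nth 0%N) big_mkord.
by apply: eq_bigr => r _; rewrite sum_nat_const card_ord.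
Qed.

(** Compare the block indices of each pair: transposition exchanges the two strict cases, one of
    which counts [dimGP], and the equal pairs fill the diagonal blocks. *)
Lemma dimGP_double (n : nat) (nu : seq nat) : sumn nu = n ->
  (2 * dimGP n nu + \sum_(k <- nu) k * k = n * n)%N.
Proof.
move=> nun; rewrite -(sum_card_blk_eq nun) /dimGP.
have -> : dimP n nu = (\sum_(a < n) \sum_(b < n) (blk nu a <= blk nu b))%N.
  rewrite pair_big /= /dimP -sum1_card big_mkcond /=.
  by apply: eq_bigr => ab _; rewrite inE; case: leqP.
have nn : (n * n = \sum_(a < n) \sum_(b < n) 1)%N.
  by rewrite sum_nat_const sum_nat_const card_ord muln1.
have E1 : (\sum_(a < n) \sum_(b < n) (blk nu a <= blk nu b) +
   \sum_(a < n) \sum_(b < n) (blk nu b < blk nu a) = n * n)%N.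
  rewrite nn -big_split; apply: eq_bigr => a _; rewrite -big_split.
  by apply: eq_bigr => b _ /=; case: leqP.
have E2 : (\sum_(a < n) \sum_(b < n) (blk nu b < blk nu a) +
   \sum_(a < n) \sum_(b < n) (blk nu a == blk nu b) =
   \sum_(a < n) \sum_(b < n) (blk nu a <= blk nu b))%N.
  rewrite [in LHS]exchange_big -big_split; apply: eq_bigr => a _; rewrite -big_split.
  by apply: eq_bigr => b _ /=; case: ltngtP.
lia.
Qed.

(** The terms [i] add up to [n (n - 1) / 2], and each part [k] removes [k (k - 1) / 2]. *)
Lemma sum_dli (n : nat) (nu : seq nat) : sumn nu = n ->
  (\sum_(1 <= i < n) dli n nu i = dimGP n nu)%N.
Proof.
move=> nun; have E1 := dimGP_double nun; have E2 := sum_subn_iota (leqnn n).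
have E3 : (2 * \sum_(k <- nu) \sum_(1 <= i < n) (k - (n - i)) + n = \sum_(k <- nu) k * k)%N.
  rewrite -{3}nun sumnE big_distrr -big_split [LHS]big_seq [RHS]big_seq.
  apply: eq_bigr => k knu /=; apply: sum_subn_iota.
  by rewrite -nun sumnE (big_rem k knu) /= leq_addr.
have : (\sum_(1 <= i < n) dli n nu i + \sum_(k <- nu) \sum_(1 <= i < n) (k - (n - i))
   = \sum_(1 <= i < n) (n - (n - i)))%N.
  rewrite exchange_big -big_split !big_nat; apply: eq_bigr => i /= ltin.
  by rewrite (dliE _ nun); have := sum_truncated_subn (n - i) nu; rewrite nun; lia.
lia.
Qed.

(** * Jordan form of a nilpotent matrix *)

Definition shift_mx (K : nzRingType) (k : nat) : 'M[K]_k :=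
  \matrix_(i, j) ((j : nat) == i.+1)%:R.

Lemma jordan_nil_cons (K : nzRingType) (k m : nat) (mu : seq nat) :
  jordan_nil K (k + m) (k :: mu) = block_mx (shift_mx K k) 0 0 (jordan_nil K m mu).
Proof.
apply/matrixP=> i j; rewrite mxE.
case: (split_ordP i) => i' ->; case: (split_ordP j) => j' ->;
  rewrite ?(block_mxEul, block_mxEur, block_mxEdl, block_mxEdr) !mxE /=.
- by rewrite !blk_cons_small // eqxx andbT; case: eqP.
- by rewrite blk_cons_small // blk_cons_add andbF.
- by rewrite (blk_cons_small _ (ltn_ord j')) blk_cons_add andbF.
- by rewrite !blk_cons_add eqSS -addnS eqn_add2l.
Qed.

Lemma shift_mulmxE (K : nzRingType) (k n : nat) (B : 'M[K]_(k, n)) (i : 'I_k) (j : 'I_n) :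
  (shift_mx K k *m B) i j = if insub i.+1 is Some i' then B i' j else 0.
Proof.
rewrite mxE; case: insubP => [i' _ ei'|ni].
  rewrite (bigD1 i') //= big1 ?addr0 => [|l /eqP nl]; first by rewrite mxE ei' eqxx mul1r.
  by rewrite mxE; case: eqP => [e|]; rewrite ?mul0r //; case: nl; apply: val_inj; rewrite /= ei'.
rewrite big1 // => l _; rewrite mxE; case: eqP => [e|]; rewrite ?mul0r //.
by case/negP: ni; rewrite -e ltn_ord.
Qed.

Lemma mulmx_shiftE (K : nzRingType) (k n : nat) (C : 'M[K]_(n, k.+1)) (i : 'I_n) (j : 'I_k.+1) :
  (C *m shift_mx K k.+1) i j = if (j : nat) is j'.+1 then C i (inord j') else 0.
Proof.
rewrite mxE; case: j => -[|j] /= lt_j.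
  by rewrite big1 // => l _; rewrite mxE mulr0.
have lt_j' : (j < k.+1)%N by apply: ltnW.
rewrite (bigD1 (inord j)) //= big1 ?addr0 => [|l /eqP nl].
  by rewrite mxE /= inordK // eqxx mulr1.
rewrite mxE /=; case: eqP => [[e]|]; rewrite ?mulr0 //; case: nl.
by apply: val_inj; rewrite /= inordK.
Qed.

(* Over K[Y], the vectors e_a Y^r span a free cyclic block of maximal length,
   and the functionals Y^s e_b cut out a Y-stable complement. *)
Lemma split_jordan_block (K : fieldType) (n k : nat) (Y : 'M[K]_n) :
  Y ^+ k.+1 = 0 -> Y ^+ k != 0 ->
  exists m : nat, exists (g : 'M[K]_(k.+1 + m, n)) (Y' : 'M[K]_m),
    [/\ n = (k.+1 + m)%N, row_free g, g *m Y = block_mx (shift_mx K k.+1) 0 0 Y' *m g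
      & Y' ^+ k.+1 = 0].
Proof.
move=> Yk1 /matrix0Pn[a [b Yab]].
(* The exponents in [C] run backwards so that [B C] is upper triangular, with the nonzero entry
   [(Y ^+ k) a b] all along its diagonal. *)
pose B : 'M[K]_(k.+1, n) := \matrix_(r, j) (Y ^+ r) a j.
pose C : 'M[K]_(n, k.+1) := \matrix_(i, s) (Y ^+ (k - s)) i b.
have Ybig j : (k < j)%N -> Y ^+ j = 0.
  by move=> lt; rewrite -(subnKC lt) exprD Yk1 mul0r.
have BY : B *m Y = shift_mx K k.+1 *m B.
  apply/matrixP=> r j; rewrite shift_mulmxE.
  have -> : (B *m Y) r j = (Y ^+ r.+1) a j.
    by rewrite exprSr mxE [RHS]mxE; apply: eq_bigr => l _; rewrite mxE.
  case: insubP => [r' _ er'|]; first by rewrite mxE er'.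
  by rewrite -leqNgt => le; rewrite Ybig // mxE.
have YC : Y *m C = C *m shift_mx K k.+1.
  apply/matrixP=> i s; rewrite mulmx_shiftE.
  have -> : (Y *m C) i s = (Y ^+ (k - s).+1) i b.
    by rewrite exprS mxE [RHS]mxE; apply: eq_bigr => l _; rewrite mxE.
  case: s => -[|s] lt_s /=; first by rewrite subn0 Yk1 mxE.
  by rewrite mxE inordK ?(ltnW lt_s) //; congr ((Y ^+ _) _ _); lia.
have BCE r s : (B *m C) r s = (Y ^+ (r + (k - s))) a b.
  by rewrite exprD mxE [RHS]mxE; apply: eq_bigr => l _; rewrite !mxE.
have BCu : B *m C \in unitmx.
  rewrite unitmxE unitfE -det_tr det_trig; last first.
    apply/is_trig_mxP => r s lt_rs; rewrite mxE BCE Ybig ?mxE //.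
    by have := ltn_ord s; lia.
  apply/prodf_neq0 => r _; rewrite mxE BCE.
  by have -> : (r + (k - r) = k)%N by have := ltn_ord r; lia.
have rankC : \rank C = k.+1.
  apply/eqP; rewrite eqn_leq rank_leq_col /=.
  by rewrite -{1}(mxrank_unit BCu) mxrankM_maxr.
(* The complement is the left kernel of [C]; [Y] preserves it because [Y C] is [C] times a shift. *)
have [N [Nfree NC [Y' NY]]] : exists N : 'M_(\rank (kermx C), n),
    [/\ row_free N, N *m C = 0 & exists Y', N *m Y = Y' *m N].
  have NC : row_base (kermx C) *m C = 0 by apply/sub_kermxP; rewrite eq_row_base.
  exists (row_base (kermx C)); split; rewrite ?row_base_free //.
  apply/submxP; rewrite eq_row_base; apply/sub_kermxP.
  by rewrite -mulmxA YC mulmxA NC mul0mx.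
exists (\rank (kermx C)), (col_mx B N), Y'; split.
- by rewrite mxrank_ker rankC subnKC // -rankC rank_leq_row.
- apply: inj_row_free => v; rewrite -[v]hsubmxK mul_row_col => e.
  have v1 : lsubmx v = 0.
    have := congr1 (mulmx^~ C) e; rewrite mulmxDl mul0mx -!mulmxA NC mulmx0 addr0.
    by move/(congr1 (mulmx^~ (invmx (B *m C)))); rewrite mulmxK // mul0mx.
  move: e; rewrite v1 mul0mx add0r => /eqP; rewrite mulmx_free_eq0 //.
  by move=> /eqP ->; rewrite row_mx0.
- by rewrite mul_col_mx mul_block_col !mul0mx addr0 add0r BY NY.
- have NYj j : N *m Y ^+ j = Y' ^+ j *m N.
    elim: j => [|j IHj]; first by rewrite !expr0 mulmx1 mul1mx.
    by rewrite !exprSr mulmxA IHj -mulmxA NY mulmxA.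
  apply/eqP; rewrite -(mulmx_free_eq0 _ Nfree).
  by rewrite -NYj Yk1 mulmx0.
Qed.

(** The least exponent killing [Y] is the size of a largest block. The complement is killed by the
    same power, so the bound on the parts, carried through the induction, keeps [mu] sorted. *)
Lemma nilpotent_jordan (K : fieldType) (n k : nat) (Y : 'M[K]_n) : Y ^+ k = 0 ->
  exists mu : seq nat, exists g : 'M[K]_n,
   [/\ sorted geq mu, all (leq^~ k) mu, all (leq 1) mu, sumn mu = n
     & g \in unitmx /\ g *m Y = jordan_nil K n mu *m g].
Proof.
have [N] := ubnP n; elim: N n k Y => // N IHN n k Y lt_nN Yk.
have [n0|n0] := posnP n.
  subst n; exists [::], 1%:M; split=> //; split; first exact: unitmx1.
  by apply/matrixP=> -[].
have exk : exists k, Y ^+ k == 0 by exists k; rewrite Yk.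
case: (ex_minnP exk) => -[|k0] /eqP Yk0 mink.
  have /matrixP/(_ (Ordinal n0) (Ordinal n0)) := Yk0.
  by rewrite expr0 !mxE eqxx => /eqP; rewrite oner_eq0.
have Yk0' : Y ^+ k0 != 0 by apply/negP => /mink; rewrite ltnn.
have le_k : (k0 < k)%N by apply: mink; rewrite Yk.
have [m [g [Y' [en gfree gY Yk']]]] := split_jordan_block Yk0 Yk0'.
subst n; have [|mu [g' [ss sk s0 sn [g'u g'Y]]]] := IHN m k0.+1 Y' _ Yk'; first by lia.
exists (k0.+1 :: mu), (block_mx 1%:M 0 0 g' *m g); split => /=.
- by rewrite path_sortedE ?ss ?andbT //; exact: rev_trans leq_trans.
- by rewrite le_k; apply: sub_all sk => j /= /leq_trans; apply.
- by rewrite s0.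
- by rewrite sn.
- split.
    rewrite unitmx_mul; apply/andP; split; last by rewrite -row_free_unit.
    by rewrite unitmxE det_ublock det1 mul1r -unitmxE.
  rewrite -mulmxA gY !mulmxA jordan_nil_cons !mulmx_block; congr (block_mx _ _ _ _ *m _);
  by rewrite ?(mul0mx, mulmx0, mul1mx, mulmx1, addr0, add0r).
Qed.

(** * An upper triangular matrix with nonzero minors on its top rows *)

(** Euclid's argument: [q] takes the value 1 on [s], so its root is new. The factor ['X] keeps [q]
    nonconstant when [s] is empty. *)
Lemma closed_field_uniq_seq (K : closedFieldType) (n : nat) :
  exists s : seq K, uniq s /\ size s = n.
Proof.
elim: n => [|n [s [us ss]]]; first by exists [::].
pose q : {poly K} := 'X * \prod_(a <- s) ('X - a%:P) + 1.
have sq : size q = n.+2.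
  rewrite /q size_polyDl; rewrite mulrC size_mulX ?monic_neq0 ?monic_prod_XsubC //;
  by rewrite ?size_poly1 size_prod_XsubC ss.
have [x qx] : exists x, root q x by apply/closed_rootP; rewrite sq.
exists (x :: s); split; rewrite /= ?ss // us andbT; apply/negP => xs.
have /rootP rx : root (\prod_(a <- s) ('X - a%:P)) x by rewrite root_prod_XsubC.
by move: qx; rewrite rootE /q hornerD hornerM rx mulr0 add0r hornerC oner_eq0.
Qed.

(** Newton's interpolation polynomials evaluated at the nodes. Unlike a Vandermonde matrix it is
    upper triangular, yet its minors on the top rows are Vandermonde determinants. *)
Definition newton_mx (K : fieldType) (n : nat) (x : nat -> K) : 'M[K]_n :=
  \matrix_(a, b) \prod_(c < a) (x b - x c).

Lemma newton_mx_upper (K : fieldType) (n : nat) (x : nat -> K) (a b : 'I_n) :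
  (b < a)%N -> newton_mx n x a b = 0.
Proof. by move=> lt_ba; rewrite mxE (bigD1 (Ordinal lt_ba)) //= subrr mul0r. Qed.

Lemma newton_mx_diag (K : fieldType) (n : nat) (x : nat -> K) (a : 'I_n) :
  (forall a b, (a < n)%N -> (b < n)%N -> x a = x b -> a = b) ->
  newton_mx n x a a != 0.
Proof.
move=> x_inj; rewrite mxE; apply/prodf_neq0 => c _; rewrite subr_eq0; apply/eqP => e.
have lt_cn : (c < n)%N by apply: ltn_trans (ltn_ord c) (ltn_ord a).
by have := ltn_ord c; rewrite -(x_inj _ _ (ltn_ord a) lt_cn e) ltnn.
Qed.

Lemma newton_mx_unit (K : fieldType) (n : nat) (x : nat -> K) :
  (forall a b, (a < n)%N -> (b < n)%N -> x a = x b -> a = b) ->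
  newton_mx n x \in unitmx.
Proof.
move=> x_inj; rewrite unitmxE unitfE -det_tr det_trig.
  by apply/prodf_neq0 => a _; rewrite mxE newton_mx_diag.
by apply/is_trig_mxP => a b lt_ab; rewrite mxE newton_mx_upper.
Qed.

(** The Newton polynomial [N a] is monic of degree [a], so the passage to monomials is
    unitriangular. *)
Lemma newton_mx_minor (K : fieldType) (n i : nat) (x : nat -> K) (le_in : (i <= n)%N)
    (f : 'I_i -> 'I_n) :
  (forall a b, (a < n)%N -> (b < n)%N -> x a = x b -> a = b) ->
  injective f ->
  \det (\matrix_(a, b) newton_mx n x (widen_ord le_in a) (f b)) != 0.
Proof.
move=> x_inj fI; pose N a := \prod_(c < a) ('X - (x c)%:P).
have sN a : size (N a) = a.+1 by rewrite size_prod_XsubC /index_enum -enumT size_enum_ord.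
pose T : 'M[K]_i := \matrix_(a, k) (N a)`_k.
pose v : 'rV[K]_i := \row_b x (f b).
have -> : \matrix_(a, b) newton_mx n x (widen_ord le_in a) (f b) = T *m Vandermonde i v.
  apply/matrixP=> a b; rewrite !mxE.
  have -> : \prod_(c < a) (x (f b) - x c) = (N a).[x (f b)].
    by rewrite horner_prod; apply: eq_bigr => c _; rewrite !hornerE.
  rewrite (@horner_coef_wide _ i) ?sN //.
  by apply: eq_bigr => k _; rewrite !mxE.
rewrite det_mulmx mulf_neq0 //.
  rewrite det_trig; last by apply/is_trig_mxP => a k lt_ak; rewrite mxE nth_default ?sN.
  apply/prodf_neq0 => a _; rewrite mxE.
  have /eqP : lead_coef (N a) = 1 by apply/eqP; exact: monic_prod_XsubC.
  by rewrite lead_coefE sN => /eqP ->; rewrite oner_eq0.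
rewrite det_Vandermonde; apply/prodf_neq0 => a _; apply/prodf_neq0 => b lt_ab.
rewrite !mxE subr_eq0; apply/eqP => /(x_inj _ _ (ltn_ord _) (ltn_ord _)) e.
by move: lt_ab; rewrite (fI b a) ?ltnn //; exact: val_inj.
Qed.

(** * Determinants with columns moved along chains *)

(** Triangularity up to reordering by [rho], ties allowed. In a nonzero Leibniz term [rho] never
    decreases under [s], while its total is unchanged, so [s] fixes every index. *)
Lemma det_rank_triangular (R : comNzRingType) (m : nat) (M : 'M[R]_m) (rho : 'I_m -> nat) :
  (forall a b, M a b != 0 -> a = b \/ (rho a < rho b)%N) -> \det M = \prod_a M a a.
Proof.
move=> Mrho; rewrite /determinant (bigD1 1%g) //= odd_perm1 expr0 mul1r.
rewrite [X in _ + X]big1 ?addr0 => [|s ns]; first by apply: eq_bigr => a _; rewrite perm1.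
have [/forallP Ms|] := boolP [forall a, M a (s a) != 0]; last first.
  rewrite negb_forall => /existsP[a]; rewrite negbK => /eqP Ma.
  by rewrite (bigD1 a) //= Ma mul0r mulr0.
have le a : (rho a <= rho (s a) ?= iff (a == s a))%N.
  apply/leqifP; case: eqP => [<- //|ne]; by case: (Mrho _ _ (Ms a)).
case/eqP: ns; apply/permP=> a; rewrite perm1.
have [_] := leqif_sum (fun a (_ : xpredT a) => le a).
rewrite (_ : \sum_i rho (s i) = \sum_i rho i)%N; last by rewrite [RHS](reindex_perm s).
rewrite eqxx.
by move=> /esym/forallP/(_ a)/= /eqP.
Qed.

(** Only the columns in [S] can contribute a factor ['X], so degree [#|S|] requires one from
    each. *)
Lemma coef_det_linear_cols (R : comNzRingType) (m : nat) (A B : 'M[R]_m) (S : {set 'I_m}) :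
  (\det (\matrix_(a, b) ((A a b)%:P + (if b \in S then 'X * (B a b)%:P else 0))))`_#|S|
  = \det (\matrix_(a, b) if b \in S then B a b else A a b).
Proof.
rewrite -det_tr -[in RHS]det_tr /determinant coef_sum; apply: eq_bigr => s _.
pose p a : {poly R} := (A (s a) a)%:P + (if a \in S then 'X * (B (s a) a)%:P else 0).
rewrite (eq_bigr p) => [|a _]; last by rewrite !mxE.
have sp a : true -> (size (p a) <= (a \in S).+1)%N.
  move=> _; apply/leq_sizeP => j; rewrite /p coefD coefC; case: (a \in S) => /=; last first.
    by case: j => // j _; rewrite coef0 addr0.
  by case: j => [|[|j]] // _; rewrite coefXM coefC add0r.
have [_] := prod_poly_top (index_enum 'I_m) sp.
have -> : (\sum_(a < m) (a \in S) = #|S|)%N.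
  by rewrite -sum1_card [RHS]big_mkcond.
rewrite (eq_bigr (fun a => (\matrix_(a, b) if b \in S then B a b else A a b)^T a (s a))).
  by move=> <-; case: (odd_perm s); rewrite ?expr1 ?expr0 ?mulN1r ?mul1r ?coefN.
move=> a _; rewrite !mxE /p coefD.
by case: (a \in S) => /=; rewrite ?coefXM ?coefC ?coef0 ?add0r ?addr0.
Qed.

(* In the columns of complete chains (those with [n - i <= c b]) a unimodular
   column operation removes 'X; each of the others contributes a factor 'X with
   the column of its predecessor, which leaves a minor of U. *)
Lemma coef_det_chain (K : fieldType) (n i : nat) (U : 'M[K]_n)
    (c rho : 'I_n -> nat) (tau : 'I_n -> option 'I_n) (le_in : (i <= n)%N) :
  (forall f : 'I_i -> 'I_n, injective f -> \det (\matrix_(a, b) U (widen_ord le_in a) (f b)) != 0) ->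
  (forall a b, tau b = Some a -> c a = c b /\ (rho a < rho b)%N) ->
  (forall a b b', tau b = Some a -> tau b' = Some a -> b = b') ->
  (forall b, (n - i <= c b)%N -> (b < i)%N) ->
  (forall b : 'I_n, (b < i)%N -> (c b < n - i)%N -> tau b != None) ->
  (\det (\matrix_(a < i, b < i) ((U (widen_ord le_in a) (widen_ord le_in b))%:P +
     'X * (if tau (widen_ord le_in b) is Some d then U (widen_ord le_in a) d else 0)%:P)))
    `_(i - #|[set b | (n - i <= c b)%N]|) != 0.
Proof.
move=> U_minor tauP tau_inj c_ge tau_lt; set m := (n - i)%N; pose w := widen_ord le_in.
have wI : injective w by move=> a b /(congr1 val) e; apply: val_inj.
pose u a (o : option 'I_n) : K := if o is Some d then U (w a) d else 0.
pose S := [set b : 'I_i | (c (w b) < m)%N].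
pose A : 'M[{poly K}]_i := \matrix_(a, b)
  ((U (w a) (w b))%:P + (if b \in S then 'X * (u a (tau (w b)))%:P else 0)).
(* [T] adds ['X] times the predecessor to each column outside [S]; the predecessor has the same
   label, so by [c_ge] it is also among the first [i] columns. *)
pose T : 'M[{poly K}]_i := \matrix_(d, b)
  ((d == b)%:R + (if (b \notin S) && (tau (w b) == Some (w d)) then 'X else 0)).
have -> : \matrix_(a < i, b < i) ((U (w a) (w b))%:P +
     'X * (if tau (w b) is Some d then U (w a) d else 0)%:P) = A *m T.
  apply/matrixP=> a b; rewrite !mxE.
  under eq_bigr => d _ do rewrite !mxE mulrDr.
  rewrite big_split /= (bigD1 b) //= [X in _ + X + _]big1 => [|d /negPf ->]; last by rewrite mulr0.
  rewrite eqxx mulr1 addr0 -addrA; congr (_ + _).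
  have [bS|bS] := boolP (b \in S); first by rewrite big1 ?addr0 // => d _; rewrite mulr0.
  rewrite add0r /=; case E: (tau (w b)) => [d|]; last first.
    by rewrite big1 ?mulr0 // => d _; rewrite mulr0.
  have [cd _] := tauP _ _ E.
  have cd_ge : (m <= c d)%N by rewrite cd leqNgt; move: bS; rewrite inE.
  have ed : w (Ordinal (c_ge d cd_ge)) = d by apply: val_inj.
  rewrite (bigD1 (Ordinal (c_ge d cd_ge))) //= ed eqxx big1 => [|d' /eqP nd]; last first.
    case: eqP => [[e]|]; rewrite ?mulr0 //; case: nd; apply: wI; rewrite ed; exact: esym.
  by rewrite inE ed ltnNge cd_ge /= !addr0 mulrC.
have detT : \det T = 1.
  rewrite (det_rank_triangular (rho := fun b => rho (w b))) => [|a b].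
    rewrite big1 // => a _; rewrite mxE eqxx.
    case: andP => [[_ /eqP /tauP[_]]|]; rewrite ?ltnn ?addr0 //.
  rewrite mxE; case: (a =P b) => [-> |_]; first by left.
  by case: andP => [[_ /eqP /tauP[_ lt]] _|]; [right | rewrite addr0 eqxx].
have cardS : (i - #|[set b | (m <= c b)%N]| = #|S|)%N.
  have -> : #|[set b | (m <= c b)%N]| = #|~: S|.
    rewrite -(card_imset _ wI); apply: eq_card => b; rewrite !inE.
    apply/idP/imsetP => [cb|[b' b'S ->]]; last by move: b'S; rewrite !inE -leqNgt.
    exists (Ordinal (c_ge b cb)); last by apply: val_inj.
    rewrite !inE -leqNgt; suff -> : w (Ordinal (c_ge b cb)) = b by [].
    exact: val_inj.
  by have := cardsC S; rewrite card_ord; lia.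
rewrite det_mulmx detT mulr1 cardS.
pose B : 'M[K]_i := \matrix_(a, b) u a (tau (w b)).
have -> : A = \matrix_(a, b) (((\matrix_(a, b) U (w a) (w b)) a b)%:P +
     (if b \in S then 'X * (B a b)%:P else 0)).
  by apply/matrixP=> a b; rewrite !mxE.
rewrite coef_det_linear_cols.
(* The column of [U] that survives in place [b]. By [tau_lt] the default of [odflt] is never
   reached; labels are constant along chains, so [f] does not mix the two cases. *)
pose f b := if b \in S then odflt (w b) (tau (w b)) else w b.
have -> : \matrix_(a, b) (if b \in S then B a b else (\matrix_(a, b) U (w a) (w b)) a b)
    = \matrix_(a, b) U (w a) (f b).
  apply/matrixP=> a b; rewrite !mxE /f; case: ifP => //; rewrite inE => bS.
  by have := tau_lt (w b) (ltn_ord b) bS; rewrite /u; case: (tau (w b)).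
apply: U_minor => b b'.
have cf d : c (f d) = c (w d).
  rewrite /f; case: ifP => // _; case E: (tau (w d)) => [d'|] //=.
  by case: (tauP _ _ E).
move=> e; have := cf b; rewrite e cf => ec; move: e; rewrite /f.
have -> : (b' \in S) = (b \in S) by rewrite !inE ec.
case: ifP => [|_ /wI //]; rewrite inE => bS.
have := tau_lt (w b) (ltn_ord b) bS; have := tau_lt (w b') (ltn_ord b'); rewrite ec => /(_ bS).
case E: (tau (w b)) => [d|] //; case E': (tau (w b')) => [d'|] //= _ _ e.
by apply: wI; apply: (tau_inj d); rewrite // E' e.
Qed.

(** * Chain matrices and their generic conjugates *)

Definition chain_pred (n : nat) (c : 'I_n -> nat) (b : 'I_n) : option 'I_n :=
  [pick a : 'I_n | [&& (a < b)%N, c a == c b & [forall d : 'I_n, (a < d < b)%N ==> (c d != c b)]]].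

(* The nilpotent matrix permuting the basis along increasing chains, one for
   each value of the label [c]. *)
Definition chain_mx (K : nzRingType) (n : nat) (c : 'I_n -> nat) : 'M[K]_n :=
  \matrix_(a, b) (chain_pred c b == Some a)%:R.

Lemma chain_predP (n : nat) (c : 'I_n -> nat) (a b : 'I_n) :
  chain_pred c b = Some a <->
  [/\ (a < b)%N, c a = c b & forall d : 'I_n, (a < d < b)%N -> c d <> c b].
Proof.
rewrite /chain_pred; case: pickP => [a' /and3P[lt' /eqP e' /forallP no']|none]; split=> //.
- move=> [<-]; split=> // d lt_d; apply/eqP; exact: implyP (no' d) lt_d.
- case=> lt e no; congr Some; apply: val_inj; case: (ltngtP a' a) => // lt_a.
    by have /implyP := no' a; rewrite lt_a lt e eqxx => /(_ isT).
  by case: (no a'); rewrite ?lt_a.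
- case=> lt e no; have := none a; rewrite lt e eqxx /= => /negP[].
  by apply/forallP=> d; apply/implyP => /no /eqP.
Qed.

Lemma chain_pred_inj (n : nat) (c : 'I_n -> nat) (a b b' : 'I_n) :
  chain_pred c b = Some a -> chain_pred c b' = Some a -> b = b'.
Proof.
move=> /chain_predP[lt e no] /chain_predP[lt' e' no']; apply: val_inj.
case: (ltngtP b b') => // ltb.
  by case: (no' b); rewrite ?lt ?ltb // -e.
by case: (no b'); rewrite ?lt' ?ltb // -e'.
Qed.

Lemma chain_pred_None (n : nat) (c : 'I_n -> nat) (a b : 'I_n) :
  chain_pred c b = None -> (a < b)%N -> c a <> c b.
Proof.
move=> eN lt_ab e.
have P0 : (a < b)%N && (c a == c b) by rewrite lt_ab e eqxx.
case: (@arg_maxnP _ a (fun d : 'I_n => (d < b)%N && (c d == c b)) val P0)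
  => m /andP[lt_mb /eqP em] mmax.
suff /chain_predP : [/\ (m < b)%N, c m = c b & forall d : 'I_n, (m < d < b)%N -> c d <> c b].
  by rewrite eN.
split=> // d /andP[lt_md lt_db] ed.
by have := mmax d; rewrite lt_db ed eqxx => /(_ isT) /=; rewrite leqNgt lt_md.
Qed.

Lemma chain_first (n : nat) (c : 'I_n -> nat) (b : 'I_n) :
  exists a : 'I_n, c a = c b /\ chain_pred c a = None.
Proof.
case: (@arg_minnP _ b (fun d : 'I_n => c d == c b) val (eqxx _)) => m /eqP em mmin.
exists m; split=> //; case E: (chain_pred c m) => [a|] //.
have /chain_predP[lt e _] := E.
by have := mmin a; rewrite e em eqxx => /(_ isT) /=; rewrite leqNgt lt.
Qed.

(* The indices are reordered so that the first element of chain [j] comes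
   [j]-th from the end. *)
Lemma chain_order (n l : nat) (c : 'I_n -> nat) :
  (forall b, (c b < l)%N) -> (forall j, (j < l)%N -> exists b, c b = j) ->
  exists s : {perm 'I_n}, forall b : 'I_n,
    ((n - b.+1 < l)%N -> c (s b) = (n - b.+1)%N) /\
    (chain_pred c (s b) = None -> c (s b) = (n - b.+1)%N).
Proof.
move=> c_lt c_surj.
have /fin_all_exists[fst fstP] (j : 'I_l) : exists a, c a = j /\ chain_pred c a = None.
  by have [b <-] := c_surj j (ltn_ord j); apply: chain_first.
have fstI : injective fst.
  by move=> j j' e; apply: val_inj; rewrite /= -(proj1 (fstP j)) e (proj1 (fstP j')).
(* First elements of the chains by label, then everything else; [f] reads this list backwards. *)
pose r := codom fst ++ [seq b <- enum 'I_n | b \notin codom fst].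
have ur : uniq r.
  rewrite cat_uniq; apply/and3P; split; first exact/injectiveP.
    by apply/hasPn => b; rewrite mem_filter => /andP[].
  by rewrite filter_uniq // enum_uniq.
have sr : size r = n.
  rewrite -(card_uniqP ur) -[RHS](card_ord n); apply: eq_card => b.
  by rewrite mem_cat mem_filter mem_enum andbT orbN.
pose f (b : 'I_n) := nth b r (n - b.+1).
have fI : injective f.
  move=> b b'; rewrite /f (set_nth_default b) ?sr; last by have := ltn_ord b'; lia.
  move/eqP; rewrite nth_uniq ?sr //; try by [have := ltn_ord b; lia | have := ltn_ord b'; lia].
  by move=> /eqP e; apply: val_inj; have := ltn_ord b; have := ltn_ord b'; rewrite /=; lia.
have f_fst (b : 'I_n) (lt : (n - b.+1 < l)%N) : f b = fst (Ordinal lt).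
  rewrite /f nth_cat size_codom card_ord lt.
  rewrite (nth_map (Ordinal lt)) ?size_enum_ord //; congr fst.
  by apply: val_inj; rewrite /= nth_enum_ord.
exists (perm fI) => b; rewrite permE; split=> [lt|bN].
  by rewrite f_fst; case: (fstP (Ordinal lt)).
have lt_c := c_lt (f b); set j := Ordinal lt_c.
have [ej jN] := fstP j.
have lt_l : (l <= n)%N by have := leq_card fst fstI; rewrite !card_ord.
have lt_b' : (n - (c (f b)).+1 < n)%N by lia.
have ej' : (n - (Ordinal lt_b').+1 = c (f b))%N by rewrite /=; lia.
have lt_b'l : (n - (Ordinal lt_b').+1 < l)%N by rewrite ej'.
have fb' : f (Ordinal lt_b') = fst j.
  by rewrite f_fst; congr fst; apply: val_inj; exact: ej'.
suff /fI -> : f b = f (Ordinal lt_b') by rewrite ej' fb' ej.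
rewrite fb'; apply: val_inj; case: (ltngtP (f b) (fst j)) => // lt.
  by case: (chain_pred_None jN lt); rewrite ej.
by case: (chain_pred_None bN lt); rewrite ej.
Qed.

(** Conjugate by a Newton matrix [U] after the reordering of [chain_order]. From [Y U = U J] follows
    [(1 + tY) U = U + t U J], and a column of [U J] is zero or the predecessor column of [U], as in
    [coef_det_chain]. *)
Lemma chain_mx_generic (K : closedFieldType) (n l : nat) (c : 'I_n -> nat) :
  (forall b, (c b < l)%N) -> (forall j, (j < l)%N -> exists b, c b = j) ->
  exists2 g : 'M[K]_n, g \in unitmx & forall i, (i <= n)%N ->
    (ldet (g *m chain_mx K c *m invmx g) i)`_(i - #|[set b | (n - i <= c b)%N]|) != 0.
Proof.
move=> c_lt c_surj; have [s sP] := chain_order c_lt c_surj.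
have [xs [uxs sxs]] := closed_field_uniq_seq K n.
pose x a := nth 0 xs a.
have x_inj a b : (a < n)%N -> (b < n)%N -> x a = x b -> a = b.
  by move=> an bn /eqP; rewrite /x nth_uniq ?sxs // => /eqP.
have U_minor i (le_in : (i <= n)%N) f := newton_mx_minor le_in (f := f) x_inj.
have U_unit := newton_mx_unit x_inj; have U_upper := @newton_mx_upper K n x.
move: (newton_mx n x) U_minor U_unit U_upper => U U_minor U_unit U_upper {x_inj}.
pose J : 'M[K]_n := \matrix_(a, b) chain_mx K c (s a) (s b).
have JE : J = perm_mx s *m chain_mx K c *m perm_mx s^-1.
  by rewrite -row_permE -col_permE; apply/matrixP=> a b; rewrite !mxE.
exists (U *m perm_mx s); first by rewrite unitmx_mul U_unit unitmx_perm.
move=> i le_in; pose w := widen_ord le_in.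
have -> : U *m perm_mx s *m chain_mx K c *m invmx (U *m perm_mx s) = U *m J *m invmx U.
  suff -> : invmx (U *m perm_mx s) = perm_mx s^-1 *m invmx U by rewrite JE !mulmxA.
  apply: (can_inj (mulKmx (_ : U *m perm_mx s \in unitmx))).
    by rewrite unitmx_mul U_unit unitmx_perm.
  rewrite mulmxV ?unitmx_mul ?U_unit ?unitmx_perm // mulmxA -[U *m _ *m _]mulmxA.
  by rewrite -perm_mxM mulgV perm_mx1 mulmx1 mulmxV.
set Y := U *m J *m invmx U.
pose tau b := omap (s^-1)%g (chain_pred c (s b)).
pose cs b := c (s b).
have tauE b a : (tau b == Some a) = (chain_pred c (s b) == Some (s a)).
  rewrite /tau; case: (chain_pred _ _) => [d|] //=.
  by apply/eqP/eqP => -[] => [<-|->]; rewrite ?permK ?permKV.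
have tauP a b : tau b = Some a -> cs a = cs b /\ (s a < s b)%N.
  by move=> /eqP; rewrite tauE => /eqP/chain_predP[].
have tau_inj a b b' : tau b = Some a -> tau b' = Some a -> b = b'.
  move=> /eqP; rewrite tauE => /eqP e /eqP; rewrite tauE => /eqP e'.
  exact: perm_inj (chain_pred_inj e e').
(* If [i <= b], then [n - b.+1 < n - i <= cs b < l], and the order forces [cs b = n - b.+1], a
   contradiction. *)
have cs_ge b : (n - i <= cs b)%N -> (b < i)%N.
  move=> le; have := sP b; rewrite -/(cs b) => -[+ _]; have := c_lt (s b); rewrite -/(cs b).
  by have := ltn_ord b; lia.
(* Without a predecessor the label would be [n - b.+1], which is at least [n - i] for [b < i]. *)
have tau_lt (b : 'I_n) : (b < i)%N -> (cs b < n - i)%N -> tau b != None.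
  move=> lt_bi lt_c; rewrite /tau; case E: (chain_pred _ _) => //.
  by have [_ /(_ E)] := sP b; rewrite -/(cs b); lia.
have := coef_det_chain (U_minor _ le_in) tauP tau_inj cs_ge tau_lt.
have -> : #|[set b | (n - i <= cs b)%N]| = #|[set b | (n - i <= c b)%N]|.
  rewrite -(card_imset _ (@perm_inj _ s)); apply: eq_card => b; rewrite !inE.
  apply/imsetP/idP => [[b' + ->]|cb]; rewrite ?inE //.
  by exists (s^-1 b)%g; rewrite ?inE /cs permKV.
have -> : \matrix_(a < i, b < i) ((U (w a) (w b))%:P +
     'X * (if tau (w b) is Some d then U (w a) d else 0)%:P) =
   lead_sub (1%:M + 'X *: map_mx polyC Y) i *m map_mx polyC (lead_sub U i).
  have UJE a b : (U *m J) a b = if tau b is Some d then U a d else 0.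
    rewrite mxE; case E: (tau b) => [d|]; last first.
      by rewrite big1 // => d _; rewrite !mxE -tauE E mulr0.
    rewrite (bigD1 d) //= big1 ?addr0 => [|d' /negPf nd].
      by rewrite !mxE -tauE E eqxx mulr1.
    by rewrite !mxE -tauE E (inj_eq (@Some_inj _)) eq_sym nd mulr0.
  have -> : \matrix_(a < i, b < i) ((U (w a) (w b))%:P +
     'X * (if tau (w b) is Some d then U (w a) d else 0)%:P) =
     mxsub w w ((1%:M + 'X *: map_mx polyC Y) *m map_mx polyC U).
    rewrite mulmxDl mul1mx -scalemxAl -map_mxM /Y mulmxKV //.
    by apply/matrixP=> a b; rewrite !mxE -UJE mxE.
  apply/matrixP=> a b; rewrite mxE mxE [RHS]mxE.
  (* As [U] is upper triangular, its first [i] columns vanish below row [i], so the leading block of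
     the product is the product of the leading blocks. *)
  rewrite (bigID (fun d : 'I_n => (d < i)%N)) /= [X in _ + X]big1 ?addr0 => [|d]; last first.
    rewrite -leqNgt => le; rewrite [map_mx _ U _ _]mxE U_upper ?polyC0 ?mulr0 //=.
    exact: leq_trans (ltn_ord b) le.
  rewrite (big_ord_narrow le_in); apply: eq_bigr => d _.
  by rewrite (lead_subE le_in) [map_mx _ (lead_sub _ _) _ _]mxE (lead_subE le_in) [map_mx _ U _ _]mxE.
by rewrite det_mulmx det_map_mx coefMC mulf_eq0 negb_or => /andP[].
Qed.

(** * Exact degrees for the nilradical and for Jordan matrices *)

(** Blocks are intervals, so the predecessor with the same block index is the preceding index. *)
Lemma jordan_nil_chain (K : fieldType) (n : nat) (mu : seq nat) :
  jordan_nil K n mu = chain_mx K (fun b : 'I_n => blk mu b).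
Proof.
apply/matrixP=> a b; rewrite !mxE.
set C := _ && _; suff -> : (chain_pred (fun b : 'I_n => blk mu b) b == Some a) = C by case: C.
apply/eqP/idP => [/chain_predP[lt e no]|/andP[/eqP eb /eqP e]].
  rewrite /C e eqxx andbT; move: lt; rewrite leq_eqVlt => /predU1P[<- //|lt].
  have lt_n : (a.+1 < n)%N by apply: ltn_trans (ltn_ord b).
  case: (no (Ordinal lt_n)); first by rewrite /= ltnSn.
  by apply/eqP; rewrite eqn_leq -{2}e !blk_mono //= ltnW.
apply/chain_predP; split=> //; first by rewrite eb.
by move=> d; rewrite eb; lia.
Qed.

(** Indices with equal offset lie in different blocks. The chain of offset [q] meets every block
    longer than [q], so its length is [lam nu q.+1]. *)
Lemma chain_mx_in_uP (K : fieldType) (n : nat) (nu : seq nat) :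
  in_uP nu (chain_mx K (fun b : 'I_n => pos nu b)).
Proof.
move=> a b nlt; rewrite mxE; case: eqP => // /chain_predP[lt e _].
case/negP: nlt; rewrite ltn_neqAle blk_mono ?(ltnW lt) // andbT.
by apply/eqP => /(blk_pos_lt lt); rewrite e ltnn.
Qed.

Lemma size_ldet_uP (K : fieldType) (n i : nat) (nu : seq nat) (g X : 'M[K]_n) :
  sumn nu = n -> (i <= n)%N -> g \in unitmx -> in_uP nu X ->
  (size (ldet (g *m X *m invmx g) i) <= (dli n nu i).+1)%N.
Proof.
move=> nun le_in gu XP; rewrite (dliE _ nun).
have levX (a b : 'I_n) : X a b != 0 -> (blk nu a < blk nu b)%N.
  by apply: contraNT => /XP/eqP.
have := size_ldet_conj (size nu) le_in (mulmxV gu) levX.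
rewrite (big_nth 0%N) big_mkord.
by under eq_bigr => r _ do rewrite card_blk_eq //.
Qed.

(** The level is the offset in a Jordan block; level [r] holds as many indices as there are parts
    above [r]. *)
Lemma size_ldet_jordan (K : fieldType) (n i : nat) (mu : seq nat) (g : 'M[K]_n) :
  sumn mu = n -> sorted geq mu -> (i <= n)%N -> g \in unitmx ->
  (size (ldet (g *m jordan_nil K n mu *m invmx g) i) <= (i - sumn (drop (n - i) mu)).+1)%N.
Proof.
move=> mun smu le_in gu.
have levJ (a b : 'I_n) : jordan_nil K n mu a b != 0 -> (pos mu a < pos mu b)%N.
  rewrite mxE; case: ifP => [/andP[/eqP eb /eqP e] _|_]; last by rewrite eqxx.
  by apply: blk_pos_lt e; rewrite eb.
have := size_ldet_conj n le_in (mulmxV gu) levJ.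
under eq_bigr => r _ do rewrite card_pos_eq //.
rewrite sum_sorted_subn //; apply/allP=> k kmu /=.
by rewrite -mun sumnE (big_rem k kmu) /= leq_addr.
Qed.

(** Label the chains by offset: every offset below the largest part occurs, and the number of
    indices of offset at least [n - i] is what [dliE] subtracts from [i]. *)
Lemma ldet_uP_generic (K : closedFieldType) (n : nat) (nu : seq nat) : sumn nu = n ->
  exists g X : 'M[K]_n, [/\ g \in unitmx, in_uP nu X
    & forall i, (i <= n)%N -> (ldet (g *m X *m invmx g) i)`_(dli n nu i) != 0].
Proof.
move=> nun; pose c (b : 'I_n) := pos nu b; pose l := \max_(k <- nu) k.
have c_lt b : (c b < l)%N.
  have : #|[set b : 'I_n | (l <= pos nu b)%N]| = 0%N.
    rewrite (card_pos_geq _ nun) big_seq big1 // => k knu.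
    by apply/eqP; rewrite subn_eq0; apply: (@leq_bigmax_seq _ nu xpredT id).
  by move=> /eqP; rewrite cards_eq0 => /eqP/setP/(_ b); rewrite !inE leqNgt => /negbFE.
have c_surj j : (j < l)%N -> exists b, c b = j.
  move=> lt_jl; have : (0 < #|[set b : 'I_n | pos nu b == j]|)%N.
    rewrite (card_pos_eq _ nun) -has_count; apply: contraTT lt_jl.
    rewrite -all_predC => /allP nuj; rewrite -leqNgt; apply/bigmax_leqP_seq => k /nuj /= + _.
    by rewrite -leqNgt.
  by case/card_gt0P=> b; rewrite inE => /eqP <-; exists b.
have [g gu gP] := chain_mx_generic K c_lt c_surj.
exists g, (chain_mx K c); split=> // [|i le_in]; first exact: chain_mx_in_uP.
by rewrite (dliE _ nun) -(card_pos_geq _ nun); apply: gP.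
Qed.

(** The chains are the Jordan blocks themselves; positive parts make every label occur. *)
Lemma ldet_jordan_generic (K : closedFieldType) (n : nat) (mu : seq nat) :
  sumn mu = n -> all (leq 1) mu ->
  exists2 g : 'M[K]_n, g \in unitmx & forall i, (i <= n)%N ->
    (ldet (g *m jordan_nil K n mu *m invmx g) i)`_(i - sumn (drop (n - i) mu)) != 0.
Proof.
move=> mun mu_pos.
have c_lt (b : 'I_n) : (blk mu b < size mu)%N.
  have : #|[set b : 'I_n | (size mu <= blk mu b)%N]| = 0%N.
    by rewrite (card_blk_geq _ mun) drop_size.
  by move=> /eqP; rewrite cards_eq0 => /eqP/setP/(_ b); rewrite !inE leqNgt => /negbFE.
have c_surj j : (j < size mu)%N -> exists b : 'I_n, blk mu b = j.
  move=> lt_j; have : (0 < #|[set b : 'I_n | blk mu b == j]|)%N.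
    by rewrite (card_blk_eq _ mun); exact: (all_nthP 0%N mu_pos).
  by case/card_gt0P=> b; rewrite inE => /eqP <-; exists b.
have [g gu gP] := chain_mx_generic K c_lt c_surj.
exists g => // i le_in; rewrite jordan_nil_chain -(card_blk_geq _ mun); exact: gP.
Qed.

(** * Recovering the Jordan type from the degrees *)

Lemma sumn_drop_pos (m : nat) (s : seq nat) : all (leq 1) s -> (sumn (drop m s) <= sumn s - m)%N.
Proof.
elim: s m => //= k s IHs [|m] /andP[k0 s0] /=; first by rewrite subn0.
by apply: leq_trans (IHs m s0) _; lia.
Qed.

(** Consecutive tail sums differ by one part, so [lam nu j.+1] is entry [j] of [mu], or zero past
    its end; the filter in [lamseq] cuts exactly there. *)
Lemma lamseq_eq (n : nat) (nu mu : seq nat) :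
  sumn mu = n -> all (leq 1) mu ->
  (forall m, (m <= n)%N -> sumn (drop m mu) = \sum_(m.+1 <= j < n.+1) lam nu j)%N ->
  lamseq n nu = mu.
Proof.
move=> mun mu_pos tails.
have lamE j : (j < n)%N -> lam nu j.+1 = nth 0%N mu j.
  move=> lt_jn; have := tails _ (ltnW lt_jn); rewrite big_ltn // -(tails _ lt_jn).
  have [lt|ge] := ltnP j (size mu); first by rewrite (drop_nth 0%N lt) /=; lia.
  by rewrite !drop_oversize ?nth_default //=; lia.
have size_mu : (size mu <= n)%N.
  have : (size mu <= sumn mu)%N.
    by elim: mu mu_pos {mun tails lamE} => //= k s IHs /andP[k0 /IHs]; lia.
  by rewrite mun.
rewrite /lamseq -(subnKC size_mu) iotaD filter_cat map_cat.
rewrite [in X in _ ++ X](eq_in_filter (a2 := pred0)) => [|j]; last first.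
  rewrite mem_iota => /andP[]; case: j => // j lt_j lt_jn.
  by rewrite lamE ?nth_default //; lia.
rewrite filter_pred0 cats0 (eq_in_filter (a2 := predT)) => [|j]; last first.
  rewrite mem_iota; case: j => // j lt_j; rewrite lamE; last by lia.
  by apply: (all_nthP 0%N mu_pos); lia.
rewrite filter_predT -[RHS](mkseq_nth 0%N) /mkseq -[1%N]addn0 iotaDl -map_comp.
by apply/eq_in_map => j; rewrite mem_iota => lt_j /=; apply: lamE; lia.
Qed.

Lemma level_nilpotent (K : nzRingType) (n L : nat) (lev : 'I_n -> nat) (X : 'M[K]_n) :
  (forall a, (lev a < L)%N) -> (forall a b, X a b != 0 -> (lev a < lev b)%N) -> X ^+ L = 0.
Proof.
move=> levL levX.
have Xk k a b : (X ^+ k) a b != 0 -> (lev a + k <= lev b)%N.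
  elim: k a => [|k IHk] a.
    by rewrite expr0 mxE addn0; case: (a =P b) => [-> //|_]; rewrite eqxx.
  rewrite exprS mxE => nz.
  have [d nzd] : exists d, X a d * (X ^+ k) d b != 0.
    apply/existsP; apply: contraNT nz; rewrite negb_exists => /forallP z.
    by rewrite big1 // => d _; apply/eqP; have := z d; rewrite negbK.
  have Xad : X a d != 0 by apply: contraNneq nzd => ->; rewrite mul0r.
  have Xdb : (X ^+ k) d b != 0 by apply: contraNneq nzd => ->; rewrite mulr0.
  by have := levX _ _ Xad; have := IHk _ Xdb; lia.
apply/matrixP=> a b; rewrite mxE; apply/eqP/negPn/negP => /Xk.
by have := levL b; lia.
Qed.

Lemma conj_expr (K : comUnitRingType) (n k : nat) (g X : 'M[K]_n) : g \in unitmx ->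
  (g *m X *m invmx g) ^+ k = g *m X ^+ k *m invmx g.
Proof.
move=> gu; elim: k => [|k IHk]; first by rewrite !expr0 mulmx1 mulmxV.
by rewrite !exprS IHk -!mulmxE !mulmxA mulmxKV.
Qed.

(* The Jordan type mu of Y bounds the degrees of the leading minors of 1 + tY,
   and a generic conjugate of Y attains these bounds. *)
Lemma ldet_top_in_Olam (K : closedFieldType) (n : nat) (nu : seq nat) (g X : 'M[K]_n) :
  sumn nu = n -> g \in unitmx -> in_uP nu X ->
  (forall i, (1 <= i < n)%N -> (ldet (g *m X *m invmx g) i)`_(dli n nu i) != 0) ->
  in_Olam nu (g *m X *m invmx g).
Proof.
move=> nun gu XP top; set Y := g *m X *m invmx g.
have levX (a b : 'I_n) : X a b != 0 -> (blk nu a < blk nu b)%N.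
  by apply: contraNT => /XP/eqP.
have Ynil : Y ^+ (size nu).+1 = 0.
  rewrite conj_expr // (level_nilpotent _ levX) ?mulmx0 ?mul0mx // => a.
  by rewrite ltnS -[X in (_ <= X)%N](size_iota 0) -(size_map (fun r => sumn (take r.+1 nu))) count_size.
have [mu [h [smu _ mu_pos mun [hu hY]]]] := nilpotent_jordan Ynil.
have YE : Y = invmx h *m jordan_nil K n mu *m invmx (invmx h).
  by rewrite invmxK -mulmxA -hY mulKmx.
have JE : jordan_nil K n mu = h *m Y *m invmx h by rewrite hY mulmxK.
have nz_size (q : {poly K}) d e : q`_d != 0 -> (size q <= e.+1)%N -> (d <= e)%N.
  by move=> nz sz; rewrite leqNgt; apply/negP => lt; case/eqP: nz; rewrite nth_default // (leq_trans sz).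
have [h' h'u h'P] := ldet_jordan_generic K mun mu_pos.
(* Compare degrees for the minor of size [i = n - m]. The cases [m = 0] and [n <= m] are settled
   directly, as [top] covers only [1 <= i < n]. *)
have tails m : (m <= n)%N -> (sumn (drop m mu) = \sum_(m.+1 <= j < n.+1) lam nu j)%N.
  move=> le_mn; have le1 := sumn_drop_pos m mu_pos.
  rewrite (sum_lam _ nun); have le2 := sum_truncated_subn m nu.
  have [->|m0] := posnP m.
    rewrite drop0 mun -nun sumnE; by apply: eq_bigr => k _; rewrite subn0.
  have [ge|lt_mn] := leqP n m; first by lia.
  have i1 : (1 <= n - m < n)%N by lia.
  have le_in : (n - m <= n)%N by lia.
  (* The nonzero coefficient of [Y] obeys the bound for type [mu], so the tail of [mu] is at most
     that of [lambda]. *)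
  have := top _ i1; rewrite -/Y => /nz_size le_a.
  have {le_a} le_a := le_a (n - m - sumn (drop m mu))%N.
  have ub := size_ldet_jordan mun smu le_in (g := invmx h); rewrite unitmx_inv -YE in ub.
  rewrite (_ : n - (n - m) = m)%N in ub; last by lia.
  have {ub} {}le_a := le_a (ub hu).
  (* Conversely, the generic conjugate of the Jordan matrix is also a conjugate of [X], so its
     degree is at most [dli]. *)
  have lb := h'P _ le_in; rewrite (_ : n - (n - m) = m)%N in lb; last by lia.
  have E : h' *m jordan_nil K n mu *m invmx h' = (h' *m h *m g) *m X *m invmx (h' *m h *m g).
    rewrite JE /Y; have u1 : h' *m h *m g \in unitmx by rewrite !unitmx_mul h'u hu gu.
    apply: (can_inj (mulmxK u1)); rewrite [RHS]mulmxKV //.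
    by rewrite !mulmxA !(mulmxKV, mulmxK) // -!mulmxA.
  have u1 : h' *m h *m g \in unitmx by rewrite !unitmx_mul h'u hu gu.
  have := size_ldet_uP nun le_in u1 XP; rewrite -E => /(nz_size _ _ _ lb).
  move: le_a; rewrite (dliE _ nun) (_ : n - (n - m) = m)%N; last by lia.
  by lia.
exists (invmx h); split; first by rewrite unitmx_inv.
by rewrite (lamseq_eq mun mu_pos tails).
Qed.

(** * The top component of the splitting *)

(** Pulled-back functions are treated through their values at the points [[g, X]], which determine
    them over an algebraically closed field. *)
Theorem theorem2p4 (K : closedFieldType) (p : nat) (n : nat) (nu : seq nat) :
  prime p -> p \in [pchar K] -> is_composition n nu ->
  let sigma := Fpoly K n ^+ p.-1 in
  let D := (p.-1 * dimGP n nu)%N in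
  (* sigma_d := phi^* (degree-d part of F^(p-1)) is the degree-d component of sigma *)
  (forall d : nat, (D < d)%N ->
     forall (g X : 'M[K]_n), g \in unitmx -> in_uP nu X ->
       evalmx (hpart d sigma) (g *m X *m invmx g) = 0) /\
  (exists (g X : 'M[K]_n), [/\ g \in unitmx, in_uP nu X &
       evalmx (hpart D sigma) (g *m X *m invmx g) != 0]) /\
  (forall (g X : 'M[K]_n), g \in unitmx -> in_uP nu X ->
       evalmx (hpart D sigma) (g *m X *m invmx g)
       = evalmx (flam K n nu) (g *m X *m invmx g) ^+ p.-1) /\
  (forall (g X : 'M[K]_n), g \in unitmx -> in_uP nu X ->
       ~ (in_Olam nu (g *m X *m invmx g)) ->
       evalmx (flam K n nu) (g *m X *m invmx g) = 0).
Proof.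
move=> _ _ /andP[_ /eqP nun] sigma D.
have flamE Y : evalmx (flam K n nu) Y = \prod_(1 <= i < n) (ldet Y i)`_(dli n nu i).
  rewrite evalmx_flam !big_nat; apply: eq_bigr => i /andP[_ /ltnW le_in].
  by rewrite coef_ldet.
have topP (g X : 'M[K]_n) : g \in unitmx -> in_uP nu X ->
    (size ((\prod_(1 <= i < n) ldet (g *m X *m invmx g) i) ^+ p.-1) <= D.+1)%N /\
    evalmx (hpart D sigma) (g *m X *m invmx g) = evalmx (flam K n nu) (g *m X *m invmx g) ^+ p.-1.
  move=> gu XP; rewrite flamE evalmx_hpart_Fpoly; set Y := g *m X *m invmx g.
  have szi i : (1 <= i < n)%N -> (size (ldet Y i) <= (dli n nu i).+1)%N.
    by move=> /andP[_ /ltnW le_in]; apply: size_ldet_uP.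
  have [] := prod_poly_top (index_iota 1 n) szi.
  rewrite -!big_nat (sum_dli nun); set q := \prod_(1 <= i < n) ldet Y i => szq topq.
  (* The power is a product of [p.-1] copies of [q], so bound and top coefficient come from the same
     lemma. *)
  have [] := prod_poly_top (index_enum 'I_p.-1) (p := fun=> q) (fun _ (_ : true) => szq).
  by rewrite sum_nat_const !prodr_const card_ord topq.
split.
  move=> d lt_Dd g X gu XP; rewrite evalmx_hpart_Fpoly nth_default //.
  by have [szq _] := topP g X gu XP; apply: leq_trans szq _.
split.
  have [g [X [gu XP gXP]]] := ldet_uP_generic K nun.
  exists g, X; split=> //; have [_ ->] := topP g X gu XP.
  rewrite flamE expf_neq0 // prodf_seq_neq0; apply/allP => i /=.
  by rewrite mem_index_iota => /andP[_ /ltnW/gXP].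
split=> [g X gu XP|g X gu XP nO]; first by have [_ ->] := topP g X gu XP.
(* Contrapositive: if [flam] is nonzero at the point, so is every top coefficient, and the point
   lies in the orbit. *)
apply/eqP; apply/negPn/negP; rewrite flamE prodf_seq_neq0 => /allP nz.
by apply: nO; apply: ldet_top_in_Olam => // i lt_in; apply: nz; rewrite mem_index_iota.
Qed.
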